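(* For every $\varepsilon>0$ there exist a constant $C>0$ and $n_\varepsilon\in\mathbb{N}$ such that for every $n\ge n_\varepsilon$ there is a $(\lceil Cn^2\rceil,n)$-stopping rule (using $O(n^2)$ samples from the unknown distribution) with stopping time $\tau$ such that for every distribution $F$ on $\mathbb{R}_+$, when the samples and $X_1,\dots,X_n$ are i.i.d.\ from $F$, \[ \mathbb{E}[X_\tau]\ge(0.745-\varepsilon)\cdot\mathbb{E}[\max\{X_1,\dots,X_n\}]. \]
   Context: Let $k\in\mathbb{N}_0$, $n\in\mathbb{N}$. Values $X_1,\dots,X_n$ and samples $S_1,\dots,S_k$ are i.i.d.\ according to a distribution $F$ on $\mathbb{R}_+$ with finite expectation. A $(k,n)$-stopping rule is a family $r_1,\dots,r_n$, $r_i:\mathbb{R}_+^{k+i}\to[0,1]$, where $r_i(s_1,\dots,s_k,x_1,\dots,x_i)$ is the probability of stopping at $X_i$ given samples $s$, values $x_1,\dots,x_i$, and not having stopped earlier; the rule does not depend on $F$. Its stopping time $\tau$ satisfies $\Pr[\tau=i\mid S=s,X=x]=\prod_{j<i}(1-r_j(s,x_1,\dots,x_j))\,r_i(s,x_1,\dots,x_i)$, with $X_\infty:=0$. *)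

(* Defs.v *)
From HB Require Import structures.
From mathcomp Require Import all_boot all_order all_algebra.
From mathcomp Require Import all_classical all_reals all_analysis.

Set Implicit Arguments.
Unset Strict Implicit.
Unset Printing Implicit Defensive.

Import Order.TTheory GRing.Theory Num.Theory.
Import numFieldNormedType.Exports.

Local Open Scope classical_set_scope.
Local Open Scope ring_scope.

Definition prefix_upto (R : realType) (n : nat) (i : 'I_n) (x : n.-tuple R) :
    i.+1.-tuple R :=
  [tuple tnth x (widen_ord (ltn_ord i) j) | j < i.+1].

(* Values are indexed from 0: [rule_fun i] is the r_{i+1} of the usual
   1-based indexing, so it sees the k samples and the i+1 values x_0, ..., x_i.
   The domain R_+^{k+i+1} is extended to R^{k+i+1} (any rule on R_+ extends by
   0); samples and values are nonnegative almost surely, so the extension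
   plays no role.  Measurability is what makes the law of the stopping time below
   meaningful. *)
Record stopping_rule (R : realType) (k n : nat) := StoppingRule {
  rule_fun :> forall i : 'I_n, k.-tuple R * i.+1.-tuple R -> R;
  rule_measurable : forall i : 'I_n, measurable_fun setT (@rule_fun i);
  rule_ge0 : forall (i : 'I_n) z, 0 <= @rule_fun i z;
  rule_le1 : forall (i : 'I_n) z, @rule_fun i z <= 1 }.

Definition stop_prob (R : realType) (k n : nat) (r : stopping_rule R k n)
    (i : 'I_n) (s : k.-tuple R) (x : n.-tuple R) : R :=
  (\prod_(j < n | (j < i)%N) (1 - r j (s, prefix_upto j x)))
  * r i (s, prefix_upto i x).

Section Probability.
Context (R : realType) (d : measure_display) (T : measurableType d)
  (P : probability T R).

Definition mutually_independent (I : finType) (Z : I -> {RV P >-> R}) : Prop :=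
  forall (J : {set I}) (A : I -> set R), (forall i, measurable (A i)) ->
    P (\bigcap_(i in [set` J]) (Z i @^-1` A i))
    = (\prod_(i in J) P (Z i @^-1` A i))%E.

Definition iid_from (F : probability R R) (I : finType)
    (Z : I -> {RV P >-> R}) : Prop :=
  mutually_independent Z /\
  forall (i : I) (A : set R), measurable A -> distribution P (Z i) A = F A.

Definition joint_family (k n : nat) (S : 'I_k -> {RV P >-> R})
    (X : 'I_n -> {RV P >-> R}) (u : 'I_k + 'I_n) : {RV P >-> R} :=
  match u with inl j => S j | inr i => X i end.

Definition joint_vector (k n : nat) (S : 'I_k -> {RV P >-> R})
    (X : 'I_n -> {RV P >-> R}) (w : T) : k.-tuple R * n.-tuple R :=
  ([tuple S j w | j < k], [tuple X i w | i < n]).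

(* [None] stands for tau = infinity (never stopping).  The second condition is
   Pr[tau = i | S = s, X = x] = stop_prob r i s x, i.e., stop_prob r i (S, X) is
   a version of the conditional probability of {tau = i} given (S, X).  The
   rule randomizes, so tau need not be a function of (S, X). *)
Definition stopping_time_of (k n : nat) (r : stopping_rule R k n)
    (S : 'I_k -> {RV P >-> R}) (X : 'I_n -> {RV P >-> R})
    (tau : T -> option 'I_n) : Prop :=
  (forall i : 'I_n, measurable (tau @^-1` [set Some i])) /\
  forall (i : 'I_n) (B : set (k.-tuple R * n.-tuple R)), measurable B ->
    P (tau @^-1` [set Some i] `&` joint_vector S X @^-1` B)
    = (\int[P]_(w in joint_vector S X @^-1` B)
         (stop_prob r i (joint_vector S X w).1 (joint_vector S X w).2)%:E)%E.

(* X_tau, with X_infinity = 0. *)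
Definition stopped_value (n : nat) (X : 'I_n -> {RV P >-> R})
    (tau : T -> option 'I_n) (w : T) : R :=
  if tau w is Some i then X i w else 0.

(* The base value 0 is harmless: the X_i are almost surely nonnegative. *)
Definition max_value (n : nat) (X : 'I_n -> {RV P >-> R}) (w : T) : R :=
  \big[Num.max/0]_(i < n) X i w.

End Probability.

Definition nonneg_finite_mean (R : realType) (F : probability R R) : Prop :=
  F [set x : R | 0 <= x] = 1%E /\ F.-integrable setT (fun x : R => x%:E).

(* Main.v *)
Require Import Defs.
From HB Require Import structures.
From Stdlib Require Import ZArith.
From mathcomp Require Import all_boot all_order all_algebra.
From mathcomp Require Import all_classical all_reals all_analysis.
From mathcomp Require Import measurable_realfun measurable_fun_approximation.
From mathcomp Require Import ssrZ ring lra.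

Set Implicit Arguments.
Unset Strict Implicit.
Unset Printing Implicit Defensive.

Import Order.TTheory GRing.Theory Num.Theory.
Import numFieldNormedType.Exports.

Local Open Scope classical_set_scope.
Local Open Scope ring_scope.

(* By the layer-cake formula it suffices to compare tails: at a level [t] with
   [a = P(X_1 > t)], the maximum exceeds [t] with probability [1 - (1 - a)^n].
   A rule whose step [i] accepts exactly the top [q_i]-quantile exceeds [t] with
   probability [\sum_i min(q_i, a) \prod_(j < i) (1 - q_j)], whatever [F] is, so one
   needs thresholds [q_i] making this at least [0.745 (1 - (1 - a)^n)] for all [a].
   Finitely many blocks of constant threshold [z_j / n] do, because the optimal
   continuous schedule takes time [\int_0^1 dy / (1/c - 1 + y (1 - ln y)) < 1] at
   [c = 0.745].  The [z_j / n]-quantile is estimated by an order statistic of the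
   samples; its expected rank is of order [n], so by Chebyshev it is accurate up to
   a factor close to 1 for all blocks at once, independently of [t]. *)

(** * A numerical certificate for the constant 0.745 *)

(* Rows [j] hold [m_j], [10^7 y_j], [10^7 G_j] with [y_j <= (1 - 1/1000)^m_j] and
   [G_j <= y_j (1 + m_j / 1000)], rounded-down substitutes for [e^-x] and
   [(1 + x) e^-x] at [x = m_j / 1000], and [10^7 t_j], a rounded-up bound for the
   duration of block [j].  The [t_j] sum to the trapezoidal rule for
   [\int_0^1 dy / (1/c - 1 + y (1 - ln y))] with [c = 0.745]; Kertz's constant is the
   [1/c] for which this integral is [1].  The [m_j] minimise the rule among
   multiples of 25, for 32 blocks. *)
Section CertificateData.
Local Open Scope Z_scope.

(** Origin of the integral: with [x = n a], [c (1 - e^-x)] is the integral of [c e^-z min(z, x) dz]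
    over [z > 0], so survival mass [c e^-z dz] has to be spent at quantile [z / n]. This lowers the
    survival probability by [c z e^-z dz = - c dG] for [G = (1 + z) e^-z]; hence it equals
    [1 - c + c G] when [z] is reached, and with [y = e^-z] the time spent is [- dy / (1/c - 1 + G)].
    On the curve [(y, G)] the slope is [z], so a block takes the slope of a chord as its threshold.
    The probabilistic obstacle is that all steps reuse the same samples, so their acceptance
    probabilities are dependent. For typical samples each step is therefore bracketed between two
    thresholds that depend on [F] only, of quantiles [(1 - kap) z / n] and [z / n]: the lower one
    bounds what is accepted, the upper one what survives. For these the expectation over the values
    factors. Atoms of [F] force the thresholds to be randomised. *)

Definition cert_m : seq nat := [:: 0; 75; 150; 225; 300; 400; 500; 600; 700;
  800; 900; 1000; 1100; 1200; 1325; 1450; 1575; 1700; 1825; 1975; 2125; 2275;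
  2450; 2625; 2825; 3050; 3300; 3575; 3900; 4325; 4900; 5850]%N.

Definition cert_y : seq Z := [:: 10000000; 9277086; 8606433; 7984262; 7407069;
  6701857; 6063787; 5486466; 4964111; 4491488; 4063863; 3676951; 3326876;
  3010131; 2656265; 2343999; 2068442; 1825279; 1610702; 1386240; 1193058;
  1026797; 861876; 723444; 592246; 472864; 368220; 279651; 202022; 132047;
  74282; 28714; 0].

Definition cert_G : seq Z := [:: 10000000; 9972867; 9897397; 9780720; 9629189;
  9382599; 9095680; 8778345; 8438988; 8084678; 7721339; 7353902; 6986439;
  6622288; 6175816; 5742797; 5326238; 4928253; 4550233; 4124064; 3728306;
  3362760; 2973472; 2622484; 2265340; 1915099; 1583346; 1279403; 989907;
  703150; 438263; 196690; 0].

Definition cert_t : seq Z := [:: 539117; 502067; 469152; 439688; 545512;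
  503992; 467172; 434244; 404575; 377664; 353107; 330578; 309808; 360470;
  333009; 307800; 284554; 263037; 289475; 263060; 238759; 250443; 222709;
  223838; 216764; 202535; 182638; 170506; 164086; 144806; 121958; 81611].

Definition cert_den : Z := 10000000.
Definition cert_thousand : Z := 1000.

Definition cert_num : Z := 745.

(** The survival probability [1 - c + c G_i], scaled by [1000 * 10^7]. *)
Definition cert_S i :=
  ((cert_thousand - cert_num) * cert_den + cert_num * cert_G`_i)%R.

Definition cert_decay j :=
  (nth 0%N cert_m j <= nth 0%N cert_m j.+1)%N &&
  (cert_y`_j.+1 * cert_thousand ^+ (nth 0%N cert_m j.+1 - nth 0%N cert_m j) <=
    cert_y`_j *
      (cert_thousand - 1) ^+ (nth 0%N cert_m j.+1 - nth 0%N cert_m j))%R.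

Definition cert_tangent j :=
  (cert_thousand * cert_G`_j <=
    cert_y`_j * (cert_thousand + Z.of_nat (nth 0%N cert_m j)))%R.

(** With denominators cleared, the last conjunct bounds the trapezoidal term [(S_j / S_j.+1 - S_j.+1
    / S_j) / 2 * (y_j - y_j.+1) / (G_j - G_j.+1)] by [t_j]; the scalings of [S], [y] and [G]
    cancel. *)
Definition cert_step j :=
  let y i := cert_y`_i in let G i := cert_G`_i in let S := cert_S in
  [&& (y j.+1 < y j)%R, (G j.+1 < G j)%R, (0 <= y j.+1)%R, (0 <= G j.+1)%R
    & ((S j * S j - S j.+1 * S j.+1) * (y j - y j.+1) * cert_den <=
       (cert_t`_j + cert_t`_j) * (S j * S j.+1 * (G j - G j.+1)))%R].

(** The chord slopes, that is the thresholds [z_j], are nondecreasing. *)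
Definition cert_incr j :=
  let y i := cert_y`_i in let G i := cert_G`_i in
  ((G j - G j.+1) * (y j.+1 - y j.+2) <= (G j.+1 - G j.+2) * (y j - y j.+1))%R.

End CertificateData.

Lemma cert_decayP : all cert_decay (iota 0 31).
Proof. by vm_compute. Qed.

Lemma cert_tangentP : all cert_tangent (iota 0 32).
Proof. by vm_compute. Qed.

Lemma cert_stepP : all cert_step (iota 0 32).
Proof. by vm_compute. Qed.

Lemma cert_incrP : all cert_incr (iota 0 31).
Proof. by vm_compute. Qed.

Lemma cert_tP : (\sum_(j <- iota 0 32) cert_t`_j <= cert_den)%R.
Proof. by rewrite unlock; vm_cast_no_check (erefl true). Qed.

(* The product of [m] factors [1 - eta], one factor [1 + m eta - n a] and
   [n - m - 1] factors [1] is at most the [n]-th power of their mean [1 - a]. *)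
Lemma AGM_tangent (R : realFieldType) (m n : nat) (eta a : R) :
  (m < n)%N -> 0 <= eta <= 1 -> 0 <= a <= 1 ->
  (1 - eta) ^+ m * (1 + m%:R * eta - n%:R * a) <= (1 - a) ^+ n.
Proof.
move=> mn /andP[eta0 eta1] /andP[a0 a1].
have [neg|pos] := ltP (1 + m%:R * eta - n%:R * a) 0.
  apply: (@le_trans _ _ 0); last by rewrite exprn_ge0 ?subr_ge0.
  by rewrite mulr_ge0_le0 ?exprn_ge0 ?subr_ge0 // ltW.
pose E (i : 'I_n) : R := if (i < m)%N then 1 - eta else
  if i == m :> nat then 1 + m%:R * eta - n%:R * a else 1.
have E0 i : i \in 'I_n -> 0 <= E i.
  by move=> _; rewrite /E; case: ifP => _; [rewrite subr_ge0|case: ifP].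
have := leif_AGM E0; rewrite cardE size_enum_ord => -[+ _].
pose e (i : nat) : R := if (i < m)%N then 1 - eta else
  if i == m then 1 + m%:R * eta - n%:R * a else 1.
have -> : \prod_(i in 'I_n) E i = (1 - eta) ^+ m * (1 + m%:R * eta - n%:R * a).
  rewrite (eq_bigl xpredT) // -(big_mkord xpredT e) (big_cat_nat (leq0n m)) //=; last exact: ltnW.
  rewrite (eq_big_nat _ _ (F2 := fun=> 1 - eta)); last by move=> i /andP[_ im]; rewrite /e im.
  rewrite prodr_const_nat subn0 big_ltn // /e ltnn eqxx big_nat_cond big1 ?mulr1 //.
  by move=> i /andP[/andP[mi _] _]; rewrite ltnNge (ltnW mi) /= gtn_eqF.
have -> : \sum_(i in 'I_n) E i = n%:R * (1 - a).
  rewrite (eq_bigl xpredT) // -(big_mkord xpredT e) (big_cat_nat (leq0n m)) //=; last exact: ltnW.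
  rewrite (eq_big_nat _ _ (F2 := fun=> 1 - eta)); last by move=> i /andP[_ im]; rewrite /e im.
  rewrite sumr_const_nat subn0 big_ltn // /e ltnn eqxx.
  rewrite (eq_big_nat _ _ (F2 := fun=> 1)); last first.
    by move=> i /andP[mi _]; rewrite ltnNge (ltnW mi) /= gtn_eqF.
  rewrite sumr_const_nat -[_ *+ m]mulr_natl.
  have -> : n%:R = m%:R + 1 + (n - m.+1)%:R :> R.
    by rewrite -{1}(subnKC mn) natrD -natr1.
  by ring.
by rewrite [_ / n%:R]mulrC mulKf // pnatr_eq0 -lt0n (leq_ltn_trans _ mn).
Qed.

(** * Transfer of integer inequalities to an ordered field *)

Section Transfer.
Variable R : realFieldType.

Definition ofZ (x : Z) : R := (int_of_Z x)%:~R.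

Lemma ofZD x y : ofZ (x + y) = ofZ x + ofZ y.
Proof. by rewrite /ofZ rmorphD /= intrD. Qed.

Lemma ofZN x : ofZ (- x) = - ofZ x.
Proof. by rewrite /ofZ rmorphN /= mulrNz. Qed.

Lemma ofZM x y : ofZ (x * y) = ofZ x * ofZ y.
Proof. by rewrite /ofZ rmorphM /= intrM. Qed.

Lemma ofZX x n : ofZ (x ^+ n) = ofZ x ^+ n.
Proof. by rewrite /ofZ rmorphXn /= rmorphXn. Qed.

Lemma ofZ_nat n : ofZ n%:R = n%:R.
Proof. by rewrite /ofZ !rmorph_nat. Qed.

Lemma ofZ_sum (s : seq nat) (F : nat -> Z) :
  ofZ (\sum_(i <- s) F i) = \sum_(i <- s) ofZ (F i).
Proof. by rewrite /ofZ raddf_sum /= raddf_sum. Qed.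

Lemma ler_ofZ x y : (ofZ x <= ofZ y) = (x <= y).
Proof.
rewrite /ofZ ler_int -subr_ge0 -rmorphB /= -[RHS]subr_ge0.
by case: (y - x).
Qed.

Lemma ltr_ofZ x y : (ofZ x < ofZ y) = (x < y).
Proof. by rewrite !ltNge ler_ofZ. Qed.

Definition ofZE := (ofZD, ofZN, ofZM, ofZX).

Lemma ofZ_cert_S j : ofZ (cert_S j) =
  (ofZ cert_thousand - ofZ cert_num) * ofZ cert_den + ofZ cert_num * ofZ cert_G`_j.
Proof. by rewrite /cert_S !ofZE. Qed.
End Transfer.
Opaque ofZ cert_S.

(** In the last clause, [y_j (1 + x_j - x)] with [y_j = e^-x_j] would be the tangent of [e^-x] at
    [x_j = m_j / 1000]. Since [(1 - a)^n] is at most [e^(-n a)], the smaller [(1 - 1/1000)^m_j]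
    replaces [e^-x_j], and [AGM_tangent] then gives the bound for every [n > m_j]. Rounding down is
    harmless: where [1 + x_j - n a] is negative the bound is trivial. *)
Lemma threshold_certificate (R : realFieldType) (c := 149 / 200 : R) :
  exists (M n0 : nat) (y G : nat -> R),
  let S j := 1 - c + c * G j in
  [/\ (0 < M)%N, y 0%N = 1, G 0%N = 1, y M = 0 & G M = 0] /\
  [/\ forall j, (j < M)%N -> y j.+1 < y j /\ G j.+1 < G j,
      forall j, (j.+1 < M)%N ->
        (G j - G j.+1) * (y j.+1 - y j.+2) <= (G j.+1 - G j.+2) * (y j - y j.+1),
      \sum_(0 <= j < M) (S j / S j.+1 - S j.+1 / S j) / 2 *
        ((y j - y j.+1) / (G j - G j.+1)) <= 1,
      forall j, (j <= M)%N -> 0 <= y j /\ 0 <= G j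
    & forall n a, (n0 <= n)%N -> 0 <= a <= 1 -> forall j, (j <= M)%N ->
        G j - y j * (n%:R * a) <= (1 - a) ^+ n].
Proof.
have c0 : 0 <= c by rewrite divr_ge0 ?ler0n.
have c1 : c < 1 by rewrite /c; lra.
have [D [D0 eD]] : exists D : R, 0 < D /\ ofZ R cert_den = D.
  by exists (ofZ R cert_den); rewrite -[0](ofZ_nat R 0) ltr_ofZ.
have DN0 : D != 0 by rewrite gt_eqF.
have [K [K0 K1 Kc eK]] : exists K : R,
    [/\ 0 < K, 1 <= K, K * c = ofZ R cert_num & ofZ R cert_thousand = K].
  exists (ofZ R cert_thousand); split; last by [].
  - by rewrite -[0](ofZ_nat R 0) ltr_ofZ.
  - by rewrite -[1](ofZ_nat R 1) ler_ofZ.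
  - have -> : cert_thousand = 5%:R * 200%:R by vm_compute.
    have -> : cert_num = 5%:R * 149%:R by vm_compute.
    by rewrite !ofZM !ofZ_nat -mulrA /c [_ * (149 / 200)]mulrC divfK ?pnatr_eq0.
clearbody c.
pose y j := ofZ R cert_y`_j / D; pose G j := ofZ R cert_G`_j / D.
have stepP j : (j < 32)%N -> cert_step j.
  by move=> j32; apply: (allP cert_stepP); rewrite mem_iota.
have yG0 j : (j <= 32)%N -> 0 <= y j /\ 0 <= G j.
  case: j => [|j] j32.
    by split; apply: divr_ge0 (ltW D0); rewrite -[0](ofZ_nat R 0) ler_ofZ.
  have /and5P[_ _ y0 G0 _] := stepP j j32.
  by split; apply: divr_ge0 (ltW D0); rewrite -[0](ofZ_nat R 0) ler_ofZ.
have yE j : ofZ R cert_y`_j = y j * D by rewrite /y divfK.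
have GE j : ofZ R cert_G`_j = G j * D by rewrite /G divfK.
have decr j : (j < 32)%N -> y j.+1 < y j /\ G j.+1 < G j.
  move=> /stepP /and5P[yl Gl _ _ _]; split.
    by rewrite /y ltr_pM2r ?invr_gt0 // ltr_ofZ.
  by rewrite /G ltr_pM2r ?invr_gt0 // ltr_ofZ.
(* [5851] exceeds every [m_j], as [AGM_tangent] requires. *)
exists 32%N, (5850.+1), y, G => S; split.
  split=> //; rewrite /y /G -?eD ?divff ?eD //; last 2 first.
  - by rewrite [ofZ _ _](ofZ_nat R 0) mul0r.
  - by rewrite [ofZ _ _](ofZ_nat R 0) mul0r.
split=> //.
- move=> j j32; have : cert_incr j by apply: (allP cert_incrP); rewrite mem_iota.
  rewrite /cert_incr -(ler_ofZ R) !ofZE !yE !GE -!mulrBl.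
  rewrite mulrACA [leRHS]mulrACA ler_pM2r ?mulr_gt0 ?invr_gt0 //.
- have SE j : ofZ R (cert_S j) = S j * (K * D).
    rewrite ofZ_cert_S GE -Kc eK eD /S. ring.
  have S0 j : (j <= 32)%N -> 0 < S j.
    move=> /yG0[_ Gj]; rewrite /S; apply: ltr_pwDl; last exact: mulr_ge0.
    by rewrite subr_gt0.
  apply: (@le_trans _ _ (\sum_(0 <= j < 32) ofZ R cert_t`_j / D)).
    rewrite big_nat_cond [leRHS]big_nat_cond; apply: ler_sum => j.
    rewrite andbT => /andP[_ j32].
    have [yl Gl] := decr j j32.
    have := S0 j (ltnW j32); have := S0 j.+1 j32 => Sj1 Sj.
    have /and5P[_ _ _ _] := stepP j j32.
    have := SE j; have := SE j.+1; move: (cert_S j) (cert_S j.+1) => s s' es' es.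
    rewrite -(ler_ofZ R) !ofZE eD !yE !GE es es' => h.
    rewrite ler_pdivlMr // -(ler_pM2r (_ :
      0 < 2 * S j * S j.+1 * (G j - G j.+1) * (K * D) * (K * D) * D)).
      apply: le_trans (le_trans _ h) _; rewrite le_eqVlt; apply/orP; left; apply/eqP.
        by field; rewrite !gt_eqF // subr_gt0.
      by ring.
    by rewrite !mulr_gt0 // ?subr_gt0 //.
  rewrite -mulr_suml ler_pdivrMr // mul1r -ofZ_sum -eD ler_ofZ.
  exact: cert_tP.
move=> n a n0 a01 j.
(* Row [32] stands for [x = infinity]: it has no [m_j], and its line is [0]. *)
have [->|j32] := eqVneq j 32%N.
  move=> _; rewrite /G /y [ofZ _ _](ofZ_nat R 0) !mul0r subr0.
  by case/andP: a01 => a0 a1; rewrite exprn_ge0 ?subr_ge0.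
rewrite leq_eqVlt (negbTE j32) /= => {}j32.
pose m i := nth 0%N cert_m i.
have decay i : (i < 32)%N -> y i <= (1 - 1 / K) ^+ m i.
  elim: i => [|i IH] i32; first by rewrite expr0 /y -eD divff ?eD.
  have : cert_decay i by apply: (allP cert_decayP); rewrite mem_iota.
  rewrite /cert_decay -/(m _) -/(m _) => /andP[mi].
  rewrite -(ler_ofZ R) !ofZE !yE eK [ofZ R 1](ofZ_nat R 1) => h.
  rewrite -(subnK mi) exprD mulrC.
  apply: le_trans (ler_wpM2r _ (IH (ltnW i32))); last first.
    by rewrite exprn_ge0 // subr_ge0 ler_pdivrMr // mul1r.
  have -> : 1 - 1 / K = (K - 1) / K by rewrite mulrBl divff ?gt_eqF.
  rewrite expr_div_n mulrA ler_pdivlMr ?exprn_gt0 //.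
  rewrite -(ler_pM2r D0); apply: le_trans (le_trans _ h) _;
    rewrite le_eqVlt; apply/orP; left; apply/eqP; ring.
have : cert_tangent j by apply: (allP cert_tangentP); rewrite mem_iota.
rewrite /cert_tangent -/(m _) -(ler_ofZ R) !ofZE !yE !GE eK.
have -> : Z.of_nat (m j) = (m j)%:R by rewrite -[X in Z.of_nat X]natn rmorph_nat.
rewrite ofZ_nat => tang.
have mn : (m j < n)%N.
  apply: leq_trans n0; rewrite ltnS.
  have : all (fun i => (m i <= 5850)%N) (iota 0 32) by [].
  by move=> /allP; apply; rewrite mem_iota.
have eta01 : 0 <= 1 / K <= 1 by rewrite divr_ge0 ?(ltW K0) //= ler_pdivrMr // mul1r.
have yj := decay j j32; have [y0 _] := yG0 j (ltnW j32).
have tang' : G j <= y j * (1 + (m j)%:R * (1 / K)).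
  rewrite -(ler_pM2r (_ : 0 < D * K)); last by rewrite mulr_gt0.
  have -> : G j * (D * K) = K * (G j * D) by ring.
  suff -> : y j * (1 + (m j)%:R * (1 / K)) * (D * K) = y j * D * (K + (m j)%:R) by [].
  by field; rewrite gt_eqF.
apply: (@le_trans _ _ (y j * (1 + (m j)%:R * (1 / K) - n%:R * a))); first by nra.
have [neg|pos] := leP (1 + (m j)%:R * (1 / K) - n%:R * a) 0.
  by apply: (le_trans (mulr_ge0_le0 y0 neg)); rewrite exprn_ge0 // subr_ge0; case/andP: a01.
by apply: le_trans (AGM_tangent mn eta01 a01); rewrite ler_wpM2r // ltW.
Qed.

(** * Thresholds in quantile space *)

Section Gain.
Variable R : realType.
Implicit Types (a : R) (s : seq (R * R)).

(* A step [(l, u)] accepts with probability at most [u], and accepts a value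
   above a level of tail probability [a] with probability at least [min l a]. *)
Fixpoint gain a s : R :=
  if s is (l, u) :: s' then Num.min l a + (1 - u) * gain a s' else 0.

Definition valid s := forall p, p \in s -> 0 <= p.1 /\ 0 <= p.2 <= 1.

Lemma gain_ge0 a s : 0 <= a -> valid s -> 0 <= gain a s.
Proof.
move=> a0; elim: s => [//|[l u] s IH] v /=.
have [/= l0 /andP[u0 u1]] := v _ (mem_head _ _).
rewrite addr_ge0 ?mulr_ge0 ?subr_ge0 // ?le_min ?l0 //.
by apply: IH => p ps; apply: v; rewrite inE ps orbT.
Qed.

Lemma gain_nseq a L l u s : gain a (nseq L (l, u) ++ s) =
  Num.min l a * \sum_(0 <= r < L) (1 - u) ^+ r + (1 - u) ^+ L * gain a s.
Proof.
elim: L => [|L IH]; first by rewrite big_nil mulr0 add0r expr0 mul1r.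
rewrite /= IH big_nat_recl //= exprS expr0.
under [X in _ = _ * (_ + X) + _]eq_bigr do rewrite exprS.
by rewrite -mulr_sumr; ring.
Qed.

(** [S i] is a guaranteed survival budget at the start of block [i], and [W i] a lower bound for the
    survival mass summed over its steps. The tail [s] stands for the steps left after the last
    block, whose gain is dropped. *)
Lemma gain_blocks a (L : nat -> nat) (l u S W : nat -> R) m j :
  0 <= a -> (forall i, 0 <= u i <= 1) -> (forall i, 0 <= l i) ->
  (forall i, (j <= i < j + m)%N -> 
     0 <= S i.+1 <= S i * (1 - u i) ^+ L i /\
     W i <= S i * \sum_(0 <= r < L i) (1 - u i) ^+ r) ->
  0 <= S j ->
  forall s, valid s ->
  \sum_(j <= i < j + m) W i * Num.min (l i) a <=
    S j * gain a (flatten [seq nseq (L i) (l i, u i) | i <- iota j m] ++ s).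
Proof.
move=> a0 u01 l0; elim: m j => [|m IH] j h Sj s vs.
  by rewrite addn0 big_geq //= mulr_ge0 // gain_ge0.
rewrite big_ltn ?addnS ?ltnS ?leq_addr //= -catA gain_nseq.
have [|/andP[S1 S1'] Wj] := h j; first by rewrite leqnn addnS ltnS leq_addr.
have min0 : 0 <= Num.min (l j) a by rewrite le_min l0.
have hj i : (j.+1 <= i < j.+1 + m)%N -> 0 <= S i.+1 <= S i * (1 - u i) ^+ L i /\
    W i <= S i * \sum_(0 <= r < L i) (1 - u i) ^+ r.
  by rewrite addSnnS => /andP[ji ij]; apply: h; rewrite (ltnW ji).
have := IH j.+1 hj S1 s vs; rewrite addSn.
set T := gain a _ => hT.
have T0 : 0 <= T.
  apply: gain_ge0 => // p; rewrite mem_cat => /orP[|]; last exact: vs.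
  by move=> /flatten_mapP[i _]; rewrite mem_nseq => /andP[_ /eqP ->] /=; split.
rewrite mulrDr; apply: lerD.
  by rewrite mulrCA [leLHS]mulrC ler_wpM2l.
by apply: le_trans hT _; rewrite mulrA ler_wpM2r.
Qed.

(** Bounds a number of steps by its survival factor without logarithms. As [(1 - u)^-1 >= 1 + u], it
    suffices that [(1 + u)^L - (1 - u)^L >= 2 L u], which follows by induction from
    [(1 + u)^L + (1 - u)^L >= 2]. *)
Lemma geometric_gap (u : R) L : 0 <= u < 1 ->
  2 * (L%:R * u) <= (1 - u) ^- L - (1 - u) ^+ L.
Proof.
move=> /andP[u0 u1].
have h : (1 + u) ^+ L <= (1 - u) ^- L.
  rewrite -exprVn; apply: lerXn2r; rewrite ?nnegrE ?invr_ge0 ?subr_ge0 ?(ltW u1) ?addr_ge0 //.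
  by rewrite -[leRHS]mul1r ler_pdivlMr ?subr_gt0 //; nra.
apply: le_trans (lerB h (lexx _)).
elim: L {h} => [|L IH]; first by rewrite mul0r mulr0 !expr0 subrr.
have p2 : 2 <= (1 + u) ^+ L + (1 - u) ^+ L.
  elim: L {IH} => [|L IH]; first by rewrite !expr0; lra.
  have : (1 - u) ^+ L <= (1 + u) ^+ L by apply: lerXn2r; rewrite ?nnegrE; lra.
  by rewrite !exprS; nra.
by rewrite !exprS -natr1; nra.
Qed.

(* Using the threshold of quantile [u] for [L] steps, the survival probability
   decreases from [S] to about [S'].  The last bound is the trapezoidal rule
   [(S - S') / 2 * (1 / S + 1 / S')]. *)
Lemma block_length (u S S' : R) : 0 < u < 1 -> 0 < S' < S -> S <= 1 ->
  exists L : nat, [/\ S' <= S * (1 - u) ^+ L,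
    (S - S') / u - 1 <= S * \sum_(0 <= r < L) (1 - u) ^+ r &
    L%:R * u <= (S / S' - S' / S) / 2].
Proof.
move=> /andP[u0 u1] /andP[S'0 S'S] S1.
have S0 := lt_trans S'0 S'S.
have u01 : 0 <= u < 1 by rewrite (ltW u0).
have bound L : S' <= S * (1 - u) ^+ L -> L%:R * u <= (S / S' - S' / S) / 2.
  move=> h; have x0 : 0 < (1 - u) ^+ L by rewrite exprn_gt0 // subr_gt0.
  have h1 : S' / S <= (1 - u) ^+ L by rewrite ler_pdivrMr // mulrC.
  have h2 : (1 - u) ^- L <= S / S'.
    by rewrite ler_pdivlMr // mulrC ler_pdivrMr.
  have := geometric_gap L u01; lra.
pose Q L := S' <= S * (1 - u) ^+ L.
have Q0 : exists L, Q L by exists 0%N; rewrite /Q expr0 mulr1 ltW.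
have QB L : Q L -> (L <= Num.truncn ((S / S' - S' / S) / 2 / u))%N.
  move=> /bound; rewrite -ler_pdivlMr // => h.
  have h0 : 0 <= (S / S' - S' / S) / 2 / u by apply: le_trans h.
  by rewrite Num.Theory.truncn_ge_nat.
(* [L] is the largest length that keeps survival at least [S']. One more step falls below [S'], so
   the survival mass of [L + 1] steps exceeds [(S - S') / u]; its last summand is at most [1]. *)
case: (ex_maxnP Q0 QB) => L QL maxL; exists L; split=> //; last exact: bound.
have : ~~ Q L.+1 by apply/negP => /maxL; rewrite ltnn.
rewrite /Q -ltNge => hL.
have geo k : u * \sum_(0 <= r < k) (1 - u) ^+ r = 1 - (1 - u) ^+ k.
  elim: k => [|k IH]; first by rewrite big_nil mulr0 expr0 subrr.
  by rewrite big_nat_recr //= mulrDr IH exprS; ring.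
have := geo L.+1; rewrite big_nat_recr //= => g.
have x1 : (1 - u) ^+ L <= 1 by rewrite exprn_ile1 // ?subr_ge0 ?(ltW u1) // gerBl ltW.
rewrite lerBlDr ler_pdivrMr //.
set sg := \sum_(0 <= r < L) _ in g *.
have e1 : S * (1 - u) ^+ L.+1 = S - S * (u * (sg + (1 - u) ^+ L)) by rewrite g; ring.
rewrite e1 in hL.
have : S * (1 - u) ^+ L <= 1
  by rewrite -[leRHS]mulr1 ler_pM // ?(ltW S0) ?exprn_ge0 ?subr_ge0 ?(ltW u1).
set x := (1 - u) ^+ L in hL *; nra.
Qed.

(** As [z] is nondecreasing, the thresholds below [x] form an initial segment. This identifies the
    affine piece of the polygon at [x]. *)
Lemma sum_min_threshold (w z : nat -> R) x M :
  (forall i j, (i <= j < M)%N -> z i <= z j) ->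
  exists2 j, (j <= M)%N & \sum_(0 <= i < M) w i * Num.min (z i) x =
    \sum_(0 <= i < j) w i * z i + (\sum_(j <= i < M) w i) * x.
Proof.
elim: M => [|M IH] zz; first by exists 0%N => //; rewrite !big_nil mul0r addr0.
have [zx|xz] := leP (z M) x.
  exists M.+1 => //; rewrite [in X in _ + X]big_geq // mul0r addr0.
  rewrite big_nat_cond [RHS]big_nat_cond; apply: eq_bigr => i /andP[/andP[_ iM] _].
  by rewrite min_l // (le_trans _ zx) // zz // -ltnS iM ltnSn.
have [|j jM e] := IH; first by move=> i j /andP[ij jM]; rewrite zz // ij ltnS ltnW.
exists j; first exact: leqW.
by rewrite big_nat_recr //= e big_nat_recr //= min_r ?(ltW xz) // mulrDl addrA.
Qed.

End Gain.

Lemma finite_natr_bound (R : realType) (f : nat -> R) M :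
  exists N : nat, forall n, (N <= n)%N -> forall j, (j < M)%N -> f j < n%:R.
Proof.
elim: M => [|M [N IH]]; first by exists 0%N.
exists (maxn N (Num.truncn (f M)).+1) => n; rewrite geq_max => /andP[Nn fn] j.
rewrite ltnS leq_eqVlt => /predU1P[->|]; last exact: IH.
by apply: (lt_le_trans (Num.Theory.truncnS_gt _)); rewrite ler_nat.
Qed.

(* With [S_j = 1 - c + c G_j] the survival probability at the start of block [j] and
   [c (y_j - y_j.+1)] the survival mass spent there, the gain is, in [a], a
   polygon lying above the tangent [c (1 - G_j + y_j n a)] of [c (1 - e^(-na))]
   on its [j]-th segment. *)
Lemma schedule (R : realType) (k : R) : 0 < k < 1 ->
  exists (M n0 : nat) (z : nat -> R),
  [/\ (0 < M)%N, forall j, 0 < z j & forall n, (n0 <= n)%N ->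
   exists b : nat -> nat, (forall i, (b i < M)%N) /\
   forall a, 0 <= a <= 1 ->
   (1 - k) ^+ 2 * (149 / 200) * (1 - (1 - a) ^+ n) <=
   gain a [seq ((1 - k) * (z (b i) / n%:R), z (b i) / n%:R) | i <- iota 0 n]].
Proof.
move=> /andP[k0 k1].
have [M [n0 [y [G /= [[M0 y0 G0 yM GM] [dec incr time yG0 tang]]]]]] := threshold_certificate R.
set c : R := 149 / 200.
have c0 : 0 < c by rewrite divr_gt0 ?ltr0n.
have c1 : c < 1 by rewrite /c; lra.
rewrite -/c in time; clearbody c.
pose S j := 1 - c + c * G j.
pose w j := c * (y j - y j.+1).
(* The default [1] keeps [z] positive at every index. *)
pose z j := if (j < M)%N then (G j - G j.+1) / (y j - y j.+1) else 1.
have dy j : (j < M)%N -> 0 < y j - y j.+1 by move=> /dec[h _]; rewrite subr_gt0.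
have dG j : (j < M)%N -> 0 < G j - G j.+1 by move=> /dec[_ h]; rewrite subr_gt0.
have z0 j : 0 < z j.
  by rewrite /z; case: ifP => // jM; rewrite divr_gt0 ?dy ?dG.
have zE j : (j < M)%N -> z j = (G j - G j.+1) / (y j - y j.+1) by rewrite /z => ->.
have w0 j : (j < M)%N -> 0 < w j by move=> jM; rewrite mulr_gt0 ?dy.
have dS j : (j < M)%N -> S j - S j.+1 = w j * z j.
  move=> jM; rewrite zE // /S /w; field; by rewrite gt_eqF ?dy.
have Spos j : (j <= M)%N -> 0 < S j.
  move=> /yG0[_ Gj]; apply: ltr_pwDl; first by rewrite subr_gt0.
  by rewrite mulr_ge0 // ltW.
have S0 : S 0%N = 1 by rewrite /S G0 mulr1 subrK.
have Sdec j : (j < M)%N -> S j.+1 < S j.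
  by move=> jM; rewrite -subr_gt0 dS // mulr_gt0 ?w0.
have Sle1 j : (j <= M)%N -> S j <= 1.
  elim: j => [|j IH] jM; first by rewrite S0.
  by rewrite (le_trans (ltW (Sdec _ jM))) // IH // ltnW.
have zmono i j : (i <= j < M)%N -> z i <= z j.
  elim: j => [|j IH]; first by rewrite leqn0 => /andP[/eqP ->].
  rewrite leq_eqVlt => /andP[/predU1P[->//|ij] jM].
  apply: le_trans (IH _) _; first by rewrite -ltnS ij ltnW.
  rewrite !zE ?(ltnW jM) // ler_pdivrMr ?dy ?(ltnW jM) // mulrAC ler_pdivlMr ?dy //.
  exact: incr.
have [n1 hn1] := finite_natr_bound z M.
(* [k w_j n > 1] lets a factor [1 - k] absorb the [- 1] of [block_length]. *)
have [n2 hn2] := finite_natr_bound (fun j => (k * w j)^-1) M.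
exists M, (maxn (maxn n0 1) (maxn n1 n2)), z; split=> // n.
rewrite !geq_max -andbA => /and4P[n0n n_gt0 n1n n2n].
have nR0 : 0 < n%:R :> R by rewrite ltr0n.
pose u j := z j / n%:R.
have u0 j : 0 < u j by rewrite divr_gt0.
have u1 j : (j < M)%N -> u j < 1.
  by move=> jM; rewrite ltr_pdivrMr // mul1r hn1.
have /choice[L hL] : forall j, exists L : nat, (j < M)%N ->
    [/\ S j.+1 <= S j * (1 - u j) ^+ L,
    (S j - S j.+1) / u j - 1 <= S j * \sum_(0 <= r < L) (1 - u j) ^+ r &
    L%:R * u j <= (S j / S j.+1 - S j.+1 / S j) / 2].
  move=> j; have [jM|_] := boolP (j < M)%N; last by exists 0%N.
  have [||| L hL] := @block_length _ (u j) (S j) (S j.+1); last by exists L.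
  - by rewrite u0 u1.
  - by rewrite Spos ?Sdec.
  - by rewrite Sle1 // ltnW.
(* Dividing the length bound by [u j = z j / n] gives [n] times the [j]-th term of the sum bounded
   by [1] in the certificate. *)
have sumL : (\sum_(0 <= j < M) L j <= n)%N.
  rewrite -(ler_nat R) natr_sum.
  apply: (@le_trans _ _ (n%:R * 1)); last by rewrite mulr1.
  apply: le_trans (ler_wpM2l (ltW nR0) time); rewrite mulr_sumr.
  rewrite big_nat_cond [leRHS]big_nat_cond; apply: ler_sum => j.
  rewrite andbT => /andP[_ jM]; have [_ _] := hL j jM.
  rewrite -/(S j) -/(S j.+1) -ler_pdivlMr ?u0 // => /le_trans; apply.
  rewrite le_eqVlt; apply/orP; left; apply/eqP; rewrite /u zE //.
  by field; rewrite !gt_eqF ?dy ?dG ?Spos // ltnW.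
pose bs := flatten [seq nseq (L j) j | j <- iota 0 M].
(* Steps beyond the last block fall back on the threshold of block [0]. *)
pose b i := nth 0%N bs i.
have size_bs : size bs = (\sum_(0 <= j < M) L j)%N.
  rewrite size_flatten /shape -map_comp sumnE big_map /index_iota subn0.
  by apply: eq_bigr => j _ /=; rewrite size_nseq.
exists b; split.
  move=> i; rewrite /b; have [ib|ib] := ltnP i (size bs); last by rewrite nth_default.
  have /flatten_mapP[j] : nth 0%N bs i \in bs by exact: mem_nth.
  by rewrite mem_iota add0n mem_nseq => /andP[_ jM] /andP[_ /eqP ->].
move=> a /[dup] a01 /andP[a0 a1].
pose f j := ((1 - k) * u j, u j) : R * R.
rewrite [X in gain a X](_ : _ = flatten [seq nseq (L i) (f i) | i <- iota 0 M] ++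
   [seq f (b i) | i <- iota (size bs) (n - size bs)]); last first.
  have sz : (size bs <= n)%N by rewrite size_bs.
  have -> : iota 0 n = iota 0 (size bs) ++ iota (size bs) (n - size bs).
    by rewrite -[in LHS](subnKC sz) iotaD.
  rewrite map_cat; congr cat.
  rewrite (map_comp f) -[[seq b i | i <- iota 0 _]]/(mkseq (nth 0%N bs) _) mkseq_nth.
  by rewrite map_flatten -map_comp; congr flatten; apply: eq_map => j /=; rewrite map_nseq.
have u01 j : 0 <= u j <= 1.
  rewrite (ltW (u0 j)) /=; have [jM|jM] := boolP (j < M)%N; first by rewrite ltW ?u1.
  by rewrite /u /z (negbTE jM) ler_pdivrMr // mul1r ler1n.
have l0 j : 0 <= (1 - k) * u j by rewrite mulr_ge0 ?(ltW (u0 _)) // subr_ge0 ltW.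
have := @gain_blocks _ a L (fun j => (1 - k) * u j) u S
  (fun j => (S j - S j.+1) / u j - 1) M 0 a0 u01 l0.
rewrite S0 !add0n => /(_ _ ler01).
set s := [seq f (b i) | i <- _] => /(_ _ s) H.
rewrite -[leRHS]mul1r; apply: le_trans (H _ _); last 2 first.
- move=> j /andP[_ jM]; have [h1 h2 _] := hL j jM; split=> //.
  by rewrite h1 andbT ltW ?Spos.
- move=> p /mapP[i _ ->] /=.
  by split; [exact: l0|exact: u01].
have [j jM e] := sum_min_threshold w (n%:R * a) zmono.
(* One factor [1 - k] pays for the rounding of block lengths ([h1]), the other for the lower
   acceptance quantile ([h2]). The remaining sums telescope to [c (1 - G_j)] and [c y_j]. *)
apply: (@le_trans _ _ ((1 - k) ^+ 2 * \sum_(0 <= i < M) w i * Num.min (z i) (n%:R * a))).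
  rewrite -mulrA ler_wpM2l ?exprn_ge0 ?subr_ge0 ?(ltW k1) // e.
  rewrite (eq_big_nat _ _ (F2 := fun i => c * G i - c * G i.+1)); last first.
    move=> i /andP[_ ij]; rewrite -dS ?(leq_trans ij) // /S; ring.
  rewrite (@telescope_sumr_eq _ _ _ (fun i => - (c * G i))) //; last first.
    by move=> i _; ring.
  rewrite (@telescope_sumr_eq _ _ _ (fun i => - (c * y i))) //; last first.
    by move=> i _; rewrite /w; ring.
  have := tang n a n0n a01 j jM; rewrite G0 yM => h.
  by nra.
rewrite mulr_sumr big_nat_cond [leRHS]big_nat_cond; apply: ler_sum => i.
rewrite andbT => /andP[_ iM].
have h1 : (1 - k) * (n%:R * w i) <= (S i - S i.+1) / u i - 1.
  rewrite dS // /u.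
  have -> : w i * z i / (z i / n%:R) = n%:R * w i.
    by move: (w i) (z i) (z0 i) => p q q0; field; rewrite !gt_eqF.
  have kw : 0 < k * w i by apply: mulr_gt0 => //; exact: w0.
  have := hn2 n n2n i iM; rewrite -div1r ltr_pdivrMr // => h.
  by nra.
have h2 : (1 - k) * (Num.min (z i) (n%:R * a) / n%:R) <= Num.min ((1 - k) * u i) a.
  have ki : 0 <= 1 - k by rewrite subr_ge0 ltW.
  rewrite le_min ler_wpM2l //=; last by rewrite ler_pM2r ?invr_gt0 // ge_min lexx.
  apply: (@le_trans _ _ (1 * a)); last by rewrite mul1r.
  apply: ler_pM => //; last by rewrite ler_pdivrMr // ge_min [a * _]mulrC lexx orbT.
    by rewrite divr_ge0 ?(ltW nR0) // le_min (ltW (z0 i)) mulr_ge0 // ltW.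
  by rewrite gerBl ltW.
have m0 : 0 <= Num.min (z i) (n%:R * a) / n%:R.
  by rewrite divr_ge0 ?(ltW nR0) // le_min (ltW (z0 i)) mulr_ge0 // ltW.
apply: le_trans (ler_pM _ _ h1 h2); last 2 first.
- by rewrite mulr_ge0 ?subr_ge0 ?(ltW k1) // mulr_ge0 ?(ltW nR0) // ltW ?w0.
- by rewrite mulr_ge0 // subr_ge0 ltW.
rewrite le_eqVlt; apply/orP; left; apply/eqP; field.
by rewrite gt_eqF.
Qed.

(** * Expectation under a finite product law *)

Section ProductExpectation.
Variables (R : realType) (E : finType) (mu : E -> R).
Hypothesis mu_ge0 : forall x, 0 <= mu x.
Hypothesis mu_sum1 : \sum_x mu x = 1.

Definition mean (f : E -> R) := \sum_x mu x * f x.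

Definition Ex (I : finType) (g : {ffun I -> E} -> R) :=
  \sum_(e : {ffun I -> E}) (\prod_i mu (e i)) * g e.

Section OneIndex.
Variable I : finType.
Implicit Types g h : {ffun I -> E} -> R.

Lemma Ex_prod (f : I -> E -> R) :
  Ex (fun e : {ffun I -> E} => \prod_i f i (e i)) = \prod_i mean (f i).
Proof.
rewrite /Ex /mean bigA_distr_bigA; apply: eq_bigr => e _.
by rewrite big_split.
Qed.

Lemma eq_Ex g h : g =1 h -> Ex g = Ex h.
Proof. by move=> gh; apply: eq_bigr => e _; rewrite gh. Qed.

Lemma le_Ex g h : (forall e, g e <= h e) -> Ex g <= Ex h.
Proof. by move=> gh; apply: ler_sum => e _; rewrite ler_wpM2l // prodr_ge0. Qed.

Lemma ExD g h : Ex (fun e => g e + h e) = Ex g + Ex h.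
Proof. by rewrite /Ex -big_split; apply: eq_bigr => e _; rewrite mulrDr. Qed.

Lemma ExZ c g : Ex (fun e => c * g e) = c * Ex g.
Proof. by rewrite /Ex mulr_sumr; apply: eq_bigr => e _; rewrite mulrCA. Qed.

Lemma Ex_sum (K : finType) (g : K -> {ffun I -> E} -> R) :
  Ex (fun e => \sum_j g j e) = \sum_j Ex (g j).
Proof. by rewrite /Ex exchange_big; apply: eq_bigr => e _; rewrite mulr_sumr. Qed.

Lemma mean1 : mean (fun=> 1) = 1.
Proof. by rewrite /mean -mulr_suml mu_sum1 mulr1. Qed.

Lemma Ex1 : Ex (fun _ : {ffun I -> E} => 1) = 1.
Proof.
rewrite (eq_Ex (h := fun e : {ffun I -> E} => \prod_(i : I) (fun (_ : I) (_ : E) => 1) i (e i))).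
  by rewrite (Ex_prod (fun _ _ => 1)) big1 // => i _; rewrite mean1.
by move=> e; rewrite big1.
Qed.

Lemma le_mean (f1 f2 : E -> R) : (forall x, f1 x <= f2 x) -> mean f1 <= mean f2.
Proof. by move=> h; apply: ler_sum => x _; rewrite ler_wpM2l. Qed.

Lemma meanB (f1 f2 : E -> R) : mean (fun x => f1 x - f2 x) = mean f1 - mean f2.
Proof. by rewrite /mean -sumrB; apply: eq_bigr => x _; rewrite mulrBr. Qed.

Lemma meanZ c f : mean (fun x => c * f x) = c * mean f.
Proof. by rewrite /mean mulr_sumr; apply: eq_bigr => x _; rewrite mulrCA. Qed.

Lemma Ex_marginal i (f : E -> R) : Ex (fun e : {ffun I -> E} => f (e i)) = mean f.
Proof.
pose F (j : I) x := if j == i then f x else 1.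
rewrite (eq_Ex (h := fun e : {ffun I -> E} => \prod_j F j (e j))).
  rewrite Ex_prod (bigD1 i) //= {1}/F eqxx big1 ?mulr1 // => j ji.
  by rewrite /F (negbTE ji) mean1.
move=> e; rewrite (bigD1 i) //= {1}/F eqxx big1 ?mulr1 // => j ji.
by rewrite /F (negbTE ji).
Qed.

Lemma Ex_marginal2 i j (f1 f2 : E -> R) : i != j ->
  Ex (fun e : {ffun I -> E} => f1 (e i) * f2 (e j)) = mean f1 * mean f2.
Proof.
move=> ij; pose F (l : I) x := if l == i then f1 x else if l == j then f2 x else 1.
rewrite (eq_Ex (h := fun e : {ffun I -> E} => \prod_l F l (e l))).
  rewrite Ex_prod (bigD1 i) //= {1}/F eqxx (bigD1 j) 1?eq_sym //=.
  rewrite {1}/F eq_sym (negbTE ij) eqxx big1 ?mulr1 // => l /andP[li lj].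
  by rewrite /F (negbTE li) (negbTE lj) mean1.
move=> e; rewrite (bigD1 i) //= {1}/F eqxx (bigD1 j) 1?eq_sym //=.
rewrite {1}/F eq_sym (negbTE ij) eqxx big1 ?mulr1 // => l /andP[li lj].
by rewrite /F (negbTE li) (negbTE lj).
Qed.

(** Independence kills the off-diagonal terms, and the variance of [f] is at most the mean of [f^2],
    hence of [f]. A bound proportional to the mean is what matters: it will be a quantile of order
    [1 / n]. *)
Lemma Ex_variance (f : E -> R) : (forall x, 0 <= f x <= 1) ->
  Ex (fun e : {ffun I -> E} => (\sum_i f (e i) - #|I|%:R * mean f) ^+ 2) <=
  #|I|%:R * mean f.
Proof.
move=> f01; pose g x := f x - mean f.
have g0 : mean g = 0.
  rewrite /g meanB [mean (fun=> mean f)](_ : _ = mean f) ?subrr //.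
  by rewrite /mean -mulr_suml mu_sum1 mul1r.
rewrite (eq_Ex (h := fun e : {ffun I -> E} => \sum_i \sum_j g (e i) * g (e j))); last first.
  move=> e; rewrite mulr_natl -sumr_const -sumrB expr2 big_distrl /=.
  by apply: eq_bigr => i _; rewrite big_distrr.
rewrite Ex_sum mulr_natl -sumr_const; apply: ler_sum => i _.
rewrite Ex_sum (bigD1 i) //= big1 ?addr0; last first.
  by move=> j ji; rewrite Ex_marginal2 ?g0 ?mul0r // eq_sym.
rewrite (Ex_marginal i (fun x => g x * g x)).
rewrite (_ : mean _ = mean (fun x => f x * f x) - mean f * mean f).
  apply: (@le_trans _ _ (mean (fun x => f x * f x))).
    by rewrite gerBl -expr2 sqr_ge0.
  by apply: le_mean => x; have /andP[h0 h1] := f01 x; rewrite -[leRHS]mulr1 ler_wpM2l.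
rewrite (_ : mean _ = mean (fun x => (f x * f x - 2 * mean f * f x) - (- (mean f * mean f) * 1))).
  rewrite !meanB !meanZ mean1; ring.
rewrite {1 2}/mean; apply: eq_bigr => x _; congr (_ * _); rewrite /g; ring.
Qed.

End OneIndex.

Lemma Ex_sumType (A B : finType) (g : {ffun A -> E} -> R) (h : {ffun B -> E} -> R) :
  Ex (fun e : {ffun A + B -> E} =>
     g [ffun i => e (inl i)] * h [ffun i => e (inr i)]) = Ex g * Ex h.
Proof.
pose F (p : {ffun A -> E} * {ffun B -> E}) : {ffun A + B -> E} :=
  [ffun u => match u with inl i => p.1 i | inr i => p.2 i end].
pose F' (e : {ffun A + B -> E}) :=
  ([ffun i => e (inl i)] : {ffun A -> E}, [ffun i => e (inr i)] : {ffun B -> E}).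
have FK : cancel F F'.
  by move=> [p q]; congr (_, _); apply/ffunP => i; rewrite !ffunE.
have F'K : cancel F' F.
  by move=> e; apply/ffunP => -[] i; rewrite !ffunE.
rewrite {1}/Ex (reindex F) /=; last by exists F' => x _; rewrite ?FK ?F'K.
rewrite /Ex big_distrlr /= pair_big /=; apply: eq_bigr => -[p q] _ /=.
have := FK (p, q); rewrite /F' => -[-> ->].
rewrite big_sumType /= mulrACA; congr (_ * _ * (_ * _)).
  by apply: eq_bigr => i _; rewrite ffunE.
by apply: eq_bigr => i _; rewrite ffunE.
Qed.

Lemma gain_iota (a : R) (l u : nat -> R) m n :
  gain a [seq (l i, u i) | i <- iota m n] =
  \sum_(i < n) Num.min (l (m + i)%N) a * \prod_(j < n | (j < i)%N) (1 - u (m + j)%N).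
Proof.
elim: n m => [|n IH] m; first by rewrite big_ord0.
rewrite /= IH big_ord_recl /= addn0 [\prod_(j < n.+1 | _) _]big_pred0 // mulr1; congr (_ + _).
rewrite mulr_sumr; apply: eq_bigr => i _.
rewrite [in RHS]big_mkcond big_ord_recl /= -big_mkcond /= addn0 addSnnS mulrCA; congr (_ * (_ * _)).
by apply: eq_big => [j|j _]; rewrite ?ltnS // addSnnS.
Qed.

(** Each summand is a product of functions of distinct coordinates, so its expectation factors; the
    steps after [i] contribute the constant [1]. *)
Lemma Ex_gain n (tau : E -> R) (f g : 'I_n -> E -> R) (l u : nat -> R) a :
  (forall i x, g i x <= 1) ->
  (forall i : 'I_n, Num.min (l i) a <= mean (fun x => tau x * f i x)) ->
  (forall i : 'I_n, mean (g i) = u i) ->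
  gain a [seq (l i, u i) | i <- iota 0 n] <=
  Ex (fun e : {ffun 'I_n -> E} => \sum_(i < n) (tau (e i) * f i (e i)) *
       \prod_(j < n | (j < i)%N) (1 - g j (e j))).
Proof.
move=> g1 hl hu; rewrite gain_iota Ex_sum; apply: ler_sum => i _.
pose F (j : 'I_n) x := if j == i then tau x * f i x
  else if (j < i)%N then 1 - g j x else 1.
rewrite (eq_Ex (h := fun e : {ffun 'I_n -> E} => \prod_j F j (e j))); last first.
  move=> e; rewrite [RHS](bigD1 i) //= {1}/F eqxx; congr (_ * _).
  rewrite big_mkcond [RHS]big_mkcond; apply: eq_bigr => j _.
  by rewrite /F; case: eqVneq => [->|//]; rewrite ltnn.
rewrite Ex_prod [X in _ <= X](bigD1 i) //= {1}/F eqxx.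
have -> : \prod_(j < n | (j < i)%N) (1 - u (0 + j)%N) = \prod_(j < n | j != i) mean (F j).
  rewrite big_mkcond [RHS]big_mkcond; apply: eq_bigr => j _.
  rewrite /F; case: eqVneq => [->|ji]; first by rewrite ltnn.
  by case: (j < i)%N; rewrite ?meanB ?mean1 ?hu.
apply: ler_wpM2r; last exact: hl.
apply: prodr_ge0 => j ji; rewrite /F (negbTE ji); case: (j < i)%N; last by rewrite mean1.
by rewrite meanB mean1 subr_ge0 -mean1; apply: le_mean.
Qed.

End ProductExpectation.

(** * Randomised quantiles *)

Section Quantile.
Context (R : realType) (F : probability R R).

Lemma le_bigcup_mu (A : nat -> set R) (q : \bar R) :
  (forall n, measurable (A n)) -> nondecreasing_seq A ->
  (forall n, (F (A n) <= q)%E) -> (F (\bigcup_n A n) <= q)%E.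
Proof.
move=> mA incr le_q.
have h : F \o A @ \oo --> F (\bigcup_n A n).
  by apply: nondecreasing_cvg_mu => //; exact: bigcup_measurable.
rewrite -(cvg_lim _ h) //; apply: lime_le; first by apply/cvg_ex; exists (F (\bigcup_n A n)).
by apply: nearW => n; exact: le_q.
Qed.

Lemma ge_bigcap_mu (A : nat -> set R) (q : \bar R) :
  (forall n, measurable (A n)) -> nonincreasing_seq A ->
  (forall n, (q <= F (A n))%E) -> (q <= F (\bigcap_n A n))%E.
Proof.
move=> mA decr ge_q.
have h : F \o A @ \oo --> F (\bigcap_n A n).
  apply: nonincreasing_cvg_mu => //; first by rewrite ltey_eq fin_num_measure.
  exact: bigcap_measurable.
rewrite -(cvg_lim _ h) //; apply: lime_ge; first by apply/cvg_ex; exists (F (\bigcap_n A n)).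
by apply: nearW => n; exact: ge_q.
Qed.

Definition tail (x : R) := fine (F `]x, +oo[%classic).
Definition wtail (x : R) := fine (F `[x, +oo[%classic).

Lemma tail_ge0 x : 0 <= tail x.
Proof. exact: fine_ge0. Qed.

Lemma EFin_tail x : (tail x)%:E = F `]x, +oo[%classic.
Proof. by rewrite fineK // fin_num_measure. Qed.

Lemma EFin_wtail x : (wtail x)%:E = F `[x, +oo[%classic.
Proof. by rewrite fineK // fin_num_measure. Qed.

Lemma tail_le1 x : tail x <= 1.
Proof. by rewrite -lee_fin EFin_tail probability_le1. Qed.

Lemma tail_wtail x : tail x <= wtail x.
Proof.
rewrite -lee_fin EFin_tail EFin_wtail le_measure ?inE //.
by move=> y /=; rewrite !in_itv /= !andbT; exact: ltW.
Qed.

Lemma tail_anti x y : x <= y -> tail y <= tail x.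
Proof.
move=> xy; rewrite -lee_fin !EFin_tail le_measure ?inE //.
by move=> z /=; rewrite !in_itv /= !andbT; exact: le_lt_trans.
Qed.

(** Take for [v] the infimum of the points of tail at most [q]. Continuity of [F] along monotone
    rays gives [tail v <= q <= wtail v], and [p] splits the atom at [v]. *)
Lemma quantile_exists q : 0 < q < 1 -> exists v p : R,
  0 <= p <= 1 /\ tail v + p * (wtail v - tail v) = q.
Proof.
move=> /andP[q0 q1].
pose B := [set x | tail x <= q].
have B0 : B !=set0.
  apply: contrapT => /set0P/negP/negPn/eqP Be.
  have : (q%:E <= F (\bigcap_n `]n%:R, +oo[%classic))%E.
    apply: ge_bigcap_mu => // [m n mn|n].
      apply/subsetPset => x /=; rewrite !in_itv /= !andbT; apply: le_lt_trans.
      by rewrite ler_nat.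
    rewrite -EFin_tail lee_fin ltW // ltNge; apply/negP => h.
    by have : B n%:R by []; rewrite Be.
  rewrite (_ : \bigcap_n _ = set0) ?measure0 ?lee_fin ?leNgt ?q0 //.
  apply/seteqP; split=> // x /(_ (Num.truncn x).+1 I) /=; rewrite in_itv /= andbT.
  by rewrite ltNge (ltW (Num.Theory.truncnS_gt _)).
have Blb : has_lbound B.
  apply: contrapT => nlb.
  have : (F (\bigcup_n `](- n%:R)%R, +oo[%classic) <= q%:E)%E.
    apply: le_bigcup_mu => // [m n mn|n].
      apply/subsetPset => x /=; rewrite !in_itv /= !andbT; apply: le_lt_trans.
      by rewrite lerN2 ler_nat.
    rewrite -EFin_tail lee_fin leNgt; apply/negP => h; apply: nlb.
    exists (- n%:R) => x Bx; rewrite leNgt; apply/negP => xn.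
    by have := lt_le_trans h (tail_anti (ltW xn)); rewrite ltNge Bx.
  rewrite (_ : \bigcup_n _ = setT) ?probability_setT ?lee_fin ?leNgt ?q1 //.
  apply/seteqP; split=> // x _; exists (Num.truncn (- x)).+1 => //=.
  by rewrite in_itv /= andbT ltrNl Num.Theory.truncnS_gt.
pose v := inf B.
have tail_gtv x : x < v -> q < tail x.
  move=> xv; rewrite ltNge; apply/negP => Bx.
  by have := ge_inf Blb Bx; rewrite leNgt xv.
have tail_ltv x : v < x -> tail x <= q.
  move=> vx; have [y By yx] := inf_lt B0 vx.
  exact: le_trans (tail_anti (ltW yx)) By.
have tv : tail v <= q.
  rewrite -lee_fin EFin_tail (_ : `]v, +oo[%classic = \bigcup_n `]v + n.+1%:R^-1, +oo[%classic).
    apply: le_bigcup_mu => // [m n mn|n].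
      apply/subsetPset => x /=; rewrite !in_itv /= !andbT; apply: le_lt_trans.
      by rewrite lerD2l lef_pV2 ?posrE ?ltr0n // ler_nat ltnS.
    by rewrite -EFin_tail lee_fin tail_ltv // ltrDl invr_gt0 ltr0n.
  apply/seteqP; split=> x /=; last first.
    by move=> [n _] /=; rewrite !in_itv /= !andbT; apply: lt_trans; rewrite ltrDl invr_gt0 ltr0n.
  rewrite in_itv /= andbT => vx; exists (Num.truncn (x - v)^-1) => //=.
  rewrite in_itv /= andbT -ltrBrDl -[ltRHS]invrK ltf_pV2 ?posrE ?ltr0n ?invr_gt0 ?subr_gt0 //.
  exact: Num.Theory.truncnS_gt.
have wv : q <= wtail v.
  rewrite -lee_fin EFin_wtail (_ : `[v, +oo[%classic = \bigcap_n `]v - n.+1%:R^-1, +oo[%classic).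
    apply: ge_bigcap_mu => // [m n mn|n].
      apply/subsetPset => x /=; rewrite !in_itv /= !andbT; apply: le_lt_trans.
      by rewrite lerD2l lerN2 lef_pV2 ?posrE ?ltr0n // ler_nat ltnS.
    by rewrite -EFin_tail lee_fin ltW // tail_gtv // gtrDl oppr_lt0 invr_gt0 ltr0n.
  apply/seteqP; split=> x /=.
    rewrite in_itv /= andbT => vx n _ /=; rewrite in_itv /= andbT; apply: lt_le_trans vx.
    by rewrite gtrDl oppr_lt0 invr_gt0 ltr0n.
  rewrite in_itv /= andbT => h; rewrite leNgt; apply/negP => xv.
  have := h (Num.truncn (v - x)^-1) I; rewrite /= in_itv /= andbT ltrBlDr -ltrBlDl.
  rewrite -[ltLHS]invrK ltf_pV2 ?posrE ?ltr0n ?invr_gt0 ?subr_gt0 //.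
  by rewrite ltNge (ltW (Num.Theory.truncnS_gt _)).
have := tail_wtail v; rewrite le_eqVlt => /predU1P[e|lt].
  by exists v, 0; rewrite lexx ler01 mul0r addr0; split=> //; apply/eqP; rewrite eq_le tv e wv.
exists v, ((q - tail v) / (wtail v - tail v)); split; last first.
  by rewrite divfK ?subr_eq0 ?gt_eqF // addrC subrK.
by rewrite divr_ge0 ?subr_ge0 ?(ltW lt) //= ler_pdivrMr ?subr_gt0 // mul1r lerD2r.
Qed.
End Quantile.

(** * Order statistics with tie breaking *)

Section Rule.
Variable R : realType.

Definition threshold (v p x : R) : R :=
  if v < x then 1 else if x == v then p else 0.

Definition n_above k (s : k.-tuple R) (x : R) := (\sum_(l < k) (x < tnth s l)%R)%N.
Definition n_equal k (s : k.-tuple R) (x : R) := (\sum_(l < k) (tnth s l == x)%R)%N.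

(* The [m]-th largest sample as a threshold, randomised at ties so that the
   samples themselves receive total weight [m].  The [Num.max 1] only matters
   when no sample equals [x]; the ratio is then a nonpositive number or at
   least 1. *)
Definition accept k (m : nat) (s : k.-tuple R) (x : R) : R :=
  Num.max 0 (Num.min 1 ((m%:R - (n_above s x)%:R) / Num.max 1 (n_equal s x)%:R)).

Lemma accept_ge0 k m (s : k.-tuple R) x : 0 <= accept m s x.
Proof. by rewrite /accept le_max lexx. Qed.

Lemma accept_le1 k m (s : k.-tuple R) x : accept m s x <= 1.
Proof. by rewrite /accept ge_max ler01 ge_min lexx. Qed.

Lemma threshold_sum k (s : k.-tuple R) v p :
  \sum_(l < k) threshold v p (tnth s l) = (n_above s v)%:R + p * (n_equal s v)%:R.
Proof.
rewrite /n_above /n_equal !natr_sum mulr_sumr -big_split; apply: eq_bigr => l _ /=.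
rewrite /threshold; case: ltgtP => _; rewrite ?mulr0 ?mulr1 ?addr0 ?add0r //.
Qed.

Lemma n_above_equal k (s : k.-tuple R) v x : v < x ->
  (n_above s x + n_equal s x <= n_above s v)%N.
Proof.
move=> vx; rewrite /n_above /n_equal -big_split /=; apply: leq_sum => l _.
case: ltgtP => //= [xs|e]; last by rewrite -e vx.
by rewrite (lt_trans vx xs).
Qed.

(** Both sides are randomised thresholds, and [accept m s] is the one built for sample weight [m].
    Comparing the total weights on the samples therefore compares the two functions at every [x],
    whether or not [x] is a sample. *)
Lemma threshold_le_accept k (s : k.-tuple R) v p m x : 0 <= p <= 1 ->
  \sum_(l < k) threshold v p (tnth s l) < m%:R -> threshold v p x <= accept m s x.
Proof.
rewrite threshold_sum => /andP[p0 p1] h.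
have hv : (n_above s v < m)%N.
  by rewrite -(ltr_nat R) (le_lt_trans _ h) // lerDl mulr_ge0.
rewrite /threshold /accept; case: ltgtP => [vx|xv|<-]; last 2 first.
- by rewrite le_max lexx.
- rewrite le_max; apply/orP; right; rewrite le_min p1 /= ler_pdivlMr ?lt_max ?ltr01 //.
  (* With no sample at [v] the denominator is [1], and [m - n_above s v >= 1] by integrality. *)
  have [e|] := posnP (n_equal s v).
    rewrite e max_l ?ler01 // mulr1 (le_trans p1) // lerBrDl natr1 ler_nat //.
  by move=> e; rewrite max_r ?ler1n //; lra.
rewrite le_max; apply/orP; right; rewrite le_min lexx /= ler_pdivlMr ?lt_max ?ltr01 // mul1r.
have h2 := n_above_equal s vx.
rewrite ge_max !lerBrDl natr1 -natrD !ler_nat; apply/andP; split.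
  by apply: leq_ltn_trans hv; apply: leq_trans h2; exact: leq_addr.
exact: leq_trans h2 (ltnW hv).
Qed.

Lemma accept_le_threshold k (s : k.-tuple R) v p m x : 0 <= p <= 1 ->
  m%:R < \sum_(l < k) threshold v p (tnth s l) -> accept m s x <= threshold v p x.
Proof.
rewrite threshold_sum => /andP[p0 p1] h.
rewrite /threshold; case: ltgtP => [vx|xv|<-]; first exact: accept_le1.
  have h2 := n_above_equal s xv.
  rewrite /accept ge_max lexx ge_min; apply/orP; right.
  rewrite ler_pdivrMr ?lt_max ?ltr01 // mul0r subr_le0.
  apply: le_trans (ltW h) (le_trans _ (_ : (n_above s v + n_equal s v)%:R <= _)).
    by rewrite natrD lerD2l -[leRHS]mul1r ler_wpM2r.
  by rewrite ler_nat.
rewrite /accept ge_max p0 ge_min; apply/orP; right.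
rewrite ler_pdivrMr ?lt_max ?ltr01 //.
have [e|] := posnP (n_equal s v).
  rewrite e max_l ?ler01 // mulr1; rewrite e mulr0 addr0 ltr_nat in h.
  by rewrite (le_trans _ p0) // subr_le0 ler_nat ltnW.
by move=> e; rewrite max_r ?ler1n //; lra.
Qed.

End Rule.

(** * Measurability of the acceptance probability *)

Section Measurability.
Context (R : realType) (d : measure_display) (T : measurableType d).

Lemma measurable_fun_natr_bool (f : T -> bool) :
  measurable_fun setT f -> measurable_fun setT (fun x => (f x)%:R : R).
Proof.
by move=> mf; apply: (@measurableT_comp _ _ _ _ _ _ (fun b : bool => b%:R : R)).
Qed.

Lemma measurable_fun_sumn (I : Type) (r : seq I) (f : I -> T -> bool) :
  (forall i, measurable_fun setT (f i)) ->
  measurable_fun setT (fun x => \sum_(i <- r) f i x)%N.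
Proof.
move=> mf; elim: r => [|i r IH].
  by under eq_fun do rewrite big_nil; exact: measurable_cst.
under eq_fun do rewrite big_cons; apply: measurable_fun_addn => //.
exact: (@measurableT_comp _ _ _ _ _ _ (fun b : bool => nat_of_bool b)).
Qed.

Lemma measurable_accept k m (s : T -> k.-tuple R) (f : T -> R) :
  measurable_fun setT s -> measurable_fun setT f ->
  measurable_fun setT (fun z => accept m (s z) (f z)).
Proof.
move=> ms mf; have ml l : measurable_fun setT (fun z => tnth (s z) l).
  by apply: (measurableT_comp (measurable_tnth l) ms).
have mnat (g : nat -> R) (h : T -> nat) :
    measurable_fun setT h -> measurable_fun setT (fun z => g (h z)).
  by move=> mh; apply: (@measurableT_comp _ _ _ _ _ _ g).
apply: measurable_maxr => //; apply: measurable_minr => //.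
apply: measurable_funM; first apply: measurable_funB => //.
  apply: (mnat (fun j => j%:R)); apply: measurable_fun_sumn => l.
  exact: measurable_fun_ltr.
apply: (mnat (fun j => (Num.max 1 j%:R)^-1)); apply: measurable_fun_sumn => l.
exact: measurable_fun_eqr.
Qed.
End Measurability.

Lemma integral_finite_fibers d (T : measurableType d) (R : realType)
    (mu : {measure set T -> \bar R}) (E : finType) (c : T -> E) (g : E -> R) :
  (forall e, measurable (c @^-1` [set e])) -> (forall e, 0 <= g e) ->
  (\int[mu]_w (g (c w))%:E = \sum_e (g e)%:E * mu (c @^-1` [set e]))%E.
Proof.
move=> mc g0.
transitivity (\int[mu]_w (\sum_e (g e)%:E * (\1_(c @^-1` [set e]) w)%:E))%E.
  apply: eq_integral => w _; rewrite (bigD1 (c w)) //= big1 ?adde0 => [|e ew].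
    by rewrite indicE mem_set //= mule1.
  rewrite indicE memNset ?mule0 //= => h; by rewrite -h eqxx in ew.
rewrite ge0_integral_sum //; last 2 first.
- by move=> e; apply: measurable_funeM; apply/measurable_EFinP; exact: measurable_indic.
- by move=> e w _; rewrite mule_ge0 // lee_fin.
apply: eq_bigr => e _; rewrite ge0_integralZl_EFin //.
  by rewrite integral_indic // setIT.
by apply/measurable_EFinP; exact: measurable_indic.
Qed.

(** * Reduction to finitely many cells *)

(* Independence is only available on measurable rectangles.  Everything that
   matters at a fixed level depends on the values only through their
   membership in finitely many sets [A i], whose joint law is a finite
   product law. *)
Section Cells.
Context (R : realType) (F : probability R R) (K : finType) (A : K -> set R).
Hypothesis mA : forall i, measurable (A i).

Definition cell (x : R) : {ffun K -> bool} := [ffun i => `[< A i x >]].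

Lemma cell_preimage e :
  cell @^-1` [set e] = \bigcap_(i in [set: K]) (if e i then A i else ~` A i).
Proof.
apply/seteqP; split=> [x <- i _|x h].
  by rewrite /cell ffunE; case: asboolP.
apply/ffunP => i; rewrite ffunE; have := h i I.
by case: (e i) => [/asboolT|/asboolF].
Qed.

Lemma measurable_cell e : measurable (cell @^-1` [set e]).
Proof.
rewrite cell_preimage; apply: fin_bigcap_measurable; first exact: finite_finset.
by move=> i _; case: (e i) => //; exact: measurableC.
Qed.

Definition cell_mass (e : {ffun K -> bool}) : R := fine (F (cell @^-1` [set e])).

Lemma cell_mass_ge0 e : 0 <= cell_mass e.
Proof. exact: fine_ge0. Qed.

Lemma EFin_cell_mass e : (cell_mass e)%:E = F (cell @^-1` [set e]).
Proof. by rewrite fineK // fin_num_measure //; exact: measurable_cell. Qed.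

Lemma integral_cell (g : {ffun K -> bool} -> R) : (forall e, 0 <= g e) ->
  (\int[F]_x (g (cell x))%:E = (mean cell_mass g)%:E)%E.
Proof.
move=> g0; rewrite integral_finite_fibers //; last exact: measurable_cell.
rewrite /mean -sumEFin; apply: eq_bigr => e _.
by rewrite EFinM EFin_cell_mass muleC.
Qed.

Lemma mean_indicator i : mean cell_mass (fun e => (e i)%:R) = fine (F (A i)).
Proof.
apply: EFin_inj; rewrite -integral_cell // fineK ?fin_num_measure //.
rewrite -[in RHS](setIT (A i)) -integral_indic //.
by apply: eq_integral => x _; rewrite /cell ffunE indicE.
Qed.

Lemma cell_mass_sum1 : \sum_e cell_mass e = 1.
Proof.
apply: EFin_inj; have := @integral_cell (fun=> 1) (fun=> ler01).
rewrite /mean; under eq_bigr do rewrite mulr1.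
by move=> <-; rewrite integral_cst // mul1e; exact: probability_setT.
Qed.

(** Membership patterns realised by no point have mass [0], so inconsistent patterns of nested rays
    can be ignored. *)
Lemma eq_mean_cell f g : (forall x, f (cell x) = g (cell x)) ->
  mean cell_mass f = mean cell_mass g.
Proof.
move=> fg; apply: eq_bigr => e _.
have [[x <-]|ne] := pselect (exists x, cell x = e); first by rewrite fg.
rewrite /cell_mass (_ : _ @^-1` _ = set0) ?measure0 ?mul0r //.
by apply/seteqP; split=> // x xe; apply: ne; exists x.
Qed.

Section Joint.
Context d (T : measurableType d) (P : probability T R) (I : finType)
  (Z : I -> {RV P >-> R}).
Hypothesis iid : iid_from F Z.

Definition joint_cell (w : T) : {ffun I -> {ffun K -> bool}} :=
  [ffun u => cell (Z u w)].

Lemma joint_cell_preimage e : joint_cell @^-1` [set e] =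
  \bigcap_(u in [set` [set: I]%SET]) (Z u @^-1` (cell @^-1` [set e u])).
Proof.
apply/seteqP; split=> [w <- u _ /=|w h]; first by rewrite ffunE.
by apply/ffunP => u; rewrite ffunE; apply: h; rewrite /= inE.
Qed.

Lemma measurable_Z u B : measurable B -> measurable (Z u @^-1` B).
Proof. by move=> mB; rewrite -[X in measurable X]setTI; exact: measurable_funPT. Qed.

Lemma measurable_joint_cell e : measurable (joint_cell @^-1` [set e]).
Proof.
rewrite joint_cell_preimage; apply: fin_bigcap_measurable; first exact: finite_finpred.
by move=> u _; apply: measurable_Z; exact: measurable_cell.
Qed.

Lemma integral_joint_cell (g : {ffun I -> {ffun K -> bool}} -> R) :
  (forall e, 0 <= g e) ->
  (\int[P]_w (g (joint_cell w))%:E = (Ex cell_mass g)%:E)%E.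
Proof.
move=> g0; rewrite integral_finite_fibers //; last exact: measurable_joint_cell.
rewrite /Ex -sumEFin; apply: eq_bigr => e _.
rewrite joint_cell_preimage; case: iid => indep ident.
rewrite EFinM muleC -prodEFin; congr (_ * _)%E.
apply: (etrans (indep [set: I]%SET (fun u => cell @^-1` [set e u])
  (fun u => measurable_cell (e u)))).
apply: eq_big => [u|u _]; first by rewrite inE.
rewrite EFin_cell_mass; apply: (ident u); exact: measurable_cell.
Qed.

End Joint.
End Cells.

(** * The rule and the tail of the stopped value *)

Section SampleRule.
Variables (R : realType) (k n : nat) (m : 'I_n -> nat).

(** Only the current value is compared with the samples; ignoring the earlier values makes survival
    a product of one-value factors. *)
Definition sample_rule_fun (i : 'I_n) (z : k.-tuple R * i.+1.-tuple R) : R :=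
  accept (m i) z.1 (tnth z.2 ord_max).

Lemma sample_rule_measurable i : measurable_fun setT (@sample_rule_fun i).
Proof.
apply: measurable_accept => //.
exact: (measurableT_comp (measurable_tnth _) measurable_snd).
Qed.

Definition sample_rule : stopping_rule R k n :=
  StoppingRule sample_rule_measurable
    (fun i z => accept_ge0 _ _ _) (fun i z => accept_le1 _ _ _).

Lemma stop_prob_sample_rule i s x : stop_prob sample_rule i s x =
  (\prod_(j < n | (j < i)%N) (1 - accept (m j) s (tnth x j))) *
  accept (m i) s (tnth x i).
Proof.
have E (j : 'I_n) : sample_rule j (s, prefix_upto j x) = accept (m j) s (tnth x j).
  rewrite /= /sample_rule_fun /= tnth_mktuple; congr (accept _ _ (tnth x _)).
  exact: val_inj.
by rewrite /stop_prob E; congr (_ * _); apply: eq_bigr => j _; rewrite E.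
Qed.

End SampleRule.

(** * Bracketing the rule at a fixed level *)

Section TailBound.
Context (R : realType) (F : probability R R) (k n : nat) (J : finType)
  (b : 'I_n -> J) (m : J -> nat) (v p : J * bool -> R) (lam : J * bool -> R).
(** [(j, false)] and [(j, true)] index the lower and the upper bracket of block [j]; the rank [m j]
    stays [lam] away from the expected sample weight of either. *)
Let q js := tail F (v js) + p js * (wtail F (v js) - tail F (v js)).
Hypothesis p01 : forall js, 0 <= p js <= 1.
Hypothesis lam_gt0 : forall js, 0 < lam js.
Hypothesis m_lower : forall j, k%:R * q (j, false) + lam (j, false) <= (m j)%:R.
Hypothesis m_upper : forall j, (m j)%:R <= k%:R * q (j, true) - lam (j, true).

Section FixedLevel.
Variable t : R.

(** [None] is the level itself. The last boolean separates the open from the closed ray at [v js];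
    it is unrelated to the bracket boolean inside [js]. *)
Let K : finType := option (J * bool * bool).

Definition level_set (i : K) : set R :=
  match i with
  | None => `]t, +oo[%classic
  | Some (js, true) => `]v js, +oo[%classic
  | Some (js, false) => `[v js, +oo[%classic
  end.

Lemma measurable_level_set i : measurable (level_set i).
Proof. by case: i => [[js []]|] /=. Qed.

Let E := {ffun K -> bool}.
Let mass := cell_mass F level_set.
Let c := cell level_set.

Definition cell_threshold (js : J * bool) (e : E) : R :=
  (e (Some (js, true)))%:R +
  p js * ((e (Some (js, false)))%:R - (e (Some (js, true)))%:R).

Definition cell_exceeds (e : E) : R := (e None)%:R.

Lemma cell_thresholdE js x : cell_threshold js (c x) = threshold (v js) (p js) x.
Proof.
rewrite /cell_threshold /c /cell !ffunE /= !in_itv /= !andbT /threshold.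
have -> : `[< v js < x >] = (v js < x) by apply/asboolP/idP.
have -> : `[< v js <= x >] = (v js <= x) by apply/asboolP/idP.
by case: ltgtP => _ /=; rewrite ?subrr ?subr0 ?mulr0 ?mulr1 ?addr0 ?add0r.
Qed.

Lemma cell_exceedsE x : cell_exceeds (c x) = (t < x)%R%:R.
Proof.
rewrite /cell_exceeds /c /cell ffunE /= in_itv /= andbT.
by congr (_%:R); congr nat_of_bool; apply/asboolP/idP.
Qed.

(** Expectations sum over all patterns, so this must cover the inconsistent one, in the open but not
    the closed ray, where the value is [1 - p js]. *)
Lemma cell_threshold01 js e : 0 <= cell_threshold js e <= 1.
Proof.
have /andP[p0 p1] := p01 js; rewrite /cell_threshold.
by case: (e _); case: (e _); rewrite /= ?subrr ?mulr0 ?addr0 ?subr0 ?sub0r ?add0r ?mulr1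
  ?mulrN1 ?lexx ?ler01 ?p0 ?p1 ?subr_ge0 ?p1 ?gerBl ?p0.
Qed.

Lemma cell_exceeds_ge0 e : 0 <= cell_exceeds e.
Proof. exact: ler0n. Qed.

Let mass_ge0 := @cell_mass_ge0 R F K level_set.
Let mass_sum1 := cell_mass_sum1 F measurable_level_set.

Lemma mean_cell_threshold js : mean mass (cell_threshold js) = q js.
Proof.
rewrite (_ : mean _ _ = mean mass (fun e => (e (Some (js, true)))%:R -
    (- p js) * ((e (Some (js, false)))%:R - (e (Some (js, true)))%:R))).
  rewrite meanB meanZ meanB !mean_indicator; try exact: measurable_level_set.
  by rewrite mulNr opprK.
by rewrite /mean; apply: eq_bigr => e _; rewrite /cell_threshold mulNr opprK.
Qed.

(** Upper sets are nested: for [t < v] whatever is accepted exceeds [t], otherwise whatever exceeds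
    [t] is accepted with probability [1]. *)
Lemma min_le_mean js :
  Num.min (q js) (tail F t) <=
  mean mass (fun e => cell_exceeds e * cell_threshold js e).
Proof.
have [tv|vt] := ltP t (v js).
  rewrite (_ : mean _ _ = q js) ?ge_min ?lexx // -mean_cell_threshold.
  apply: eq_mean_cell => x; rewrite -/c cell_exceedsE cell_thresholdE /threshold.
  case: (ltgtP (v js) x) => [vx|xv|<-]; rewrite ?mulr0 // ?mulr1 //.
    by rewrite (lt_trans tv vx).
  by rewrite tv mul1r.
rewrite (_ : mean _ _ = tail F t) ?ge_min ?lexx ?orbT //.
rewrite -[RHS](@mean_indicator _ _ _ level_set measurable_level_set None).
apply: eq_mean_cell => x; rewrite -/c -[RHS]/(cell_exceeds (c x)).
rewrite cell_exceedsE cell_thresholdE /threshold.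
by have [tx|_] := ltP t x; rewrite ?mul0r // (le_lt_trans vt tx) mulr1.
Qed.

Definition gain_of_cells (e : {ffun 'I_n -> E}) : R :=
  \sum_(i < n) (cell_exceeds (e i) * cell_threshold (b i, false) (e i)) *
    \prod_(j < n | (j < i)%N) (1 - cell_threshold (b j, true) (e j)).

Definition deviation (e : {ffun 'I_k -> E}) : R :=
  \sum_js ((\sum_l cell_threshold js (e l) - k%:R * q js) / lam js) ^+ 2.

Lemma gain_of_cells_ge0 e : 0 <= gain_of_cells e.
Proof.
apply: sumr_ge0 => i _; apply: mulr_ge0.
  by apply: mulr_ge0; [exact: cell_exceeds_ge0 | case/andP: (cell_threshold01 (b i, false) (e i))].
by apply: prodr_ge0 => j _; rewrite subr_ge0; case/andP: (cell_threshold01 (b j, true) (e j)).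
Qed.

Lemma Ex_deviation : Ex mass deviation <= \sum_js k%:R * q js / lam js ^+ 2.
Proof.
rewrite /deviation Ex_sum; apply: ler_sum => js _.
rewrite (eq_Ex _ (h := fun e : {ffun _ -> E} => (lam js ^+ 2)^-1 *
    (\sum_l cell_threshold js (e l) -
      #|'I_k|%:R * mean mass (cell_threshold js)) ^+ 2)); last first.
  by move=> e; rewrite mean_cell_threshold card_ord exprMn exprVn mulrC.
rewrite ExZ mulrC ler_wpM2r ?invr_ge0 ?exprn_ge0 ?(ltW (lam_gt0 _)) //.
have := @Ex_variance _ _ _ mass_ge0 mass_sum1 'I_k _ (cell_threshold01 js).
by rewrite -/mass mean_cell_threshold card_ord.
Qed.

(* Chebyshev in pointwise form: [1 - deviation] is nonpositive unless every
   empirical count is within [lam] of its expectation.  The samples and the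
   values then separate in expectation, whatever the level [t]. *)
Definition guaranteed (e : {ffun 'I_k + 'I_n -> E}) : R :=
  gain_of_cells [ffun i => e (inr i)] *
  (1 - deviation [ffun l => e (inl l)]).

Lemma Ex_guaranteed (l u : nat -> R) del :
  \sum_js k%:R * q js / lam js ^+ 2 <= del -> del <= 1 ->
  (forall i : 'I_n, l i = q (b i, false)) -> (forall i : 'I_n, u i = q (b i, true)) ->
  (1 - del) * gain (tail F t) [seq (l i, u i) | i <- iota 0 n] <=
  Ex mass (fun e => Num.max 0 (guaranteed e)).
Proof.
move=> hdel del1 hl hu.
apply: (@le_trans _ _ (Ex mass guaranteed)); last first.
  by apply: le_Ex => // e; rewrite le_max lexx orbT.
rewrite (eq_Ex _ (h := fun e : {ffun 'I_k + 'I_n -> E} =>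
    (fun e' => 1 - deviation e') [ffun i => e (inl i)] *
    gain_of_cells [ffun i => e (inr i)])); last by move=> e; exact: mulrC.
rewrite (@Ex_sumType _ _ mass 'I_k 'I_n (fun e' => 1 - deviation e') gain_of_cells).
apply: (@le_trans _ _ ((1 - del) * Ex mass gain_of_cells)).
  rewrite ler_wpM2l ?subr_ge0 //.
  apply: (@Ex_gain R _ mass mass_ge0 mass_sum1 n cell_exceeds
    (fun i => cell_threshold (b i, false)) (fun i => cell_threshold (b i, true))).
  - by move=> i x; case/andP: (cell_threshold01 (b i, true) x).
  - by move=> i; rewrite hl; exact: min_le_mean.
  - by move=> i; rewrite hu; exact: mean_cell_threshold.
have Y0 : 0 <= Ex mass gain_of_cells.
  apply: sumr_ge0 => e _; apply: mulr_ge0; last exact: gain_of_cells_ge0.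
  by apply: prodr_ge0 => i _; exact: mass_ge0.
apply: ler_wpM2r => //.
rewrite (eq_Ex _ (h := fun e : {ffun _ -> E} => 1 + (- 1) * deviation e));
  last by move=> e; rewrite mulN1r.
rewrite ExD ExZ Ex1 // mulN1r lerD2l lerN2.
exact: le_trans Ex_deviation hdel.
Qed.

(** If [deviation] is at least [1], the left side is [0]. Otherwise every empirical weight is within
    [lam] of its mean, so [m j] lies strictly between the weights of the two brackets, and [accept]
    lies between the brackets themselves. *)
Lemma guaranteed_le (s : k.-tuple R) (x : n.-tuple R) (e : {ffun 'I_k + 'I_n -> E}) :
  (forall l, e (inl l) = c (tnth s l)) -> (forall i, e (inr i) = c (tnth x i)) ->
  Num.max 0 (guaranteed e) <=
  \sum_(i < n) (t < tnth x i)%R%:R * stop_prob (sample_rule R k (fun i => m (b i))) i s x.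
Proof.
move=> es ex; set rhs := \sum_(i < n) _.
have rhs0 : 0 <= rhs.
  apply: sumr_ge0 => i _; rewrite stop_prob_sample_rule !mulr_ge0 ?accept_ge0 ?ler0n //.
  by apply: prodr_ge0 => j _; rewrite subr_ge0 accept_le1.
rewrite ge_max rhs0 /=.
have dev_ge0 e' : 0 <= deviation e' by apply: sumr_ge0 => js _; exact: sqr_ge0.
have [big|small] := leP 1 (deviation [ffun l => e (inl l)]).
  by apply: le_trans rhs0; rewrite mulr_ge0_le0 ?gain_of_cells_ge0 // subr_le0.
have close js : `|\sum_(l < k) threshold (v js) (p js) (tnth s l) - k%:R * q js| < lam js.
  have h : ((\sum_l cell_threshold js ([ffun l => e (inl l)] l) - k%:R * q js) / lam js) ^+ 2 < 1.
    apply: le_lt_trans small; rewrite /deviation (bigD1 js) //= lerDl.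
    by apply: sumr_ge0 => ? _; exact: sqr_ge0.
  move: h; under eq_bigr do rewrite ffunE es cell_thresholdE.
  by rewrite -real_normK ?num_real // expr_lt1 // normrM normfV
    (gtr0_norm (lam_gt0 js)) ltr_pdivrMr // mul1r.
have lower j y : threshold (v (j, false)) (p (j, false)) y <= accept (m j) s y.
  apply: threshold_le_accept => //; apply: lt_le_trans (m_lower j).
  by rewrite -ltrBlDl (le_lt_trans (ler_norm _) (close _)).
have upper j y : accept (m j) s y <= threshold (v (j, true)) (p (j, true)) y.
  apply: accept_le_threshold => //; apply: le_lt_trans (m_upper j) _.
  rewrite ltrBlDr -ltrBlDl; apply: le_lt_trans (close (j, true)).
  by rewrite distrC ler_norm.
apply: (@le_trans _ _ (gain_of_cells [ffun i => e (inr i)])).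
  by rewrite ler_piMr ?gain_of_cells_ge0 // gerBl.
apply: ler_sum => i _; rewrite stop_prob_sample_rule ffunE ex.
rewrite cell_exceedsE cell_thresholdE -mulrA ler_wpM2l ?ler0n // mulrC.
have thr01 js y : 0 <= threshold (v js) (p js) y <= 1.
  by rewrite -cell_thresholdE cell_threshold01.
apply: ler_pM => //.
- apply: prodr_ge0 => j _; rewrite ffunE ex cell_thresholdE subr_ge0.
  by case/andP: (thr01 (b j, true) (tnth x j)).
- by case/andP: (thr01 (b i, false) (tnth x i)).
apply: ler_prod => j _; rewrite ffunE ex cell_thresholdE subr_ge0.
by case/andP: (thr01 (b j, true) (tnth x j)) => _ -> /=; rewrite lerD2l lerN2.
Qed.

End FixedLevel.
End TailBound.

Lemma measurable_finite_fibers d (T : measurableType d) (R : realType)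
    (E : finType) (c : T -> E) (g : E -> R) :
  (forall e, measurable (c @^-1` [set e])) -> measurable_fun setT (fun w => g (c w)).
Proof.
move=> mc _ B mB; rewrite setTI.
rewrite (_ : _ @^-1` B = \bigcup_(e in [set e | B (g e)]) (c @^-1` [set e])).
  by apply: fin_bigcup_measurable => // e _; exact: mc.
apply/seteqP; split=> w; first by move=> Bw; exists (c w).
by move=> [e /= Be ce]; rewrite /= ce.
Qed.

(** * Law of the stopped value *)

Section StoppedTail.
Context (R : realType) (k n : nat) (d : measure_display) (T : measurableType d)
  (P : probability T R) (S : 'I_k -> {RV P >-> R}) (X : 'I_n -> {RV P >-> R})
  (tau : T -> option 'I_n) (m : 'I_n -> nat).
Let r := sample_rule R k m.
Hypothesis tau_r : stopping_time_of r S X tau.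

Lemma measurable_joint1 : measurable_fun setT (fun w => (joint_vector S X w).1).
Proof.
apply/measurable_fun_tnthP => l; rewrite (_ : _ \o _ = S l) //.
by apply/funext => w /=; rewrite tnth_mktuple.
Qed.

Lemma measurable_stop_prob i :
  measurable_fun setT (fun w => stop_prob r i (joint_vector S X w).1 (joint_vector S X w).2).
Proof.
under eq_fun do rewrite stop_prob_sample_rule.
have ma j : measurable_fun setT
    (fun w => accept (m j) (joint_vector S X w).1 (tnth (joint_vector S X w).2 j)).
  apply: measurable_accept; first exact: measurable_joint1.
  by rewrite (_ : (fun _ => _) = X j) //; apply/funext => w /=; rewrite tnth_mktuple.
apply: measurable_funM => //.
under eq_fun do rewrite big_mkcond.
apply: measurable_prod => j _.
by case: (j < i)%N => //; apply: measurable_funB.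
Qed.

Lemma measurable_stop_term t i : measurable_fun setT (fun w => (t < X i w)%R%:R *
  stop_prob r i (joint_vector S X w).1 (joint_vector S X w).2).
Proof.
apply: measurable_funM; last exact: measurable_stop_prob.
by apply: measurable_fun_natr_bool; exact: measurable_fun_ltr.
Qed.

Definition stopped_above (t : R) (i : 'I_n) : set T :=
  tau @^-1` [set Some i] `&` X i @^-1` `]t, +oo[%classic.

Lemma measurable_stopped_above t i : measurable (stopped_above t i).
Proof.
apply: measurableI; first by case: tau_r.
by rewrite -[X in measurable X]setTI; exact: measurable_funPT.
Qed.

Lemma stopped_value_above t : 0 <= t ->
  [set w | t < stopped_value X tau w] = \big[setU/set0]_(i < n) stopped_above t i.
Proof.
move=> t0; rewrite -(bigcup_seq (index_enum _)); apply/seteqP; split=> w /=.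
  rewrite /stopped_value; case E: (tau w) => [i|]; last by rewrite ltNge t0.
  by move=> tX; exists i; rewrite /= ?mem_index_enum //; split; rewrite /= ?in_itv /= ?andbT.
by move=> [i _ [/= E]]; rewrite in_itv /= andbT /stopped_value E.
Qed.

Lemma probability_stopped_above t i :
  P (stopped_above t i) =
  (\int[P]_w ((t < X i w)%R%:R *
     stop_prob r i (joint_vector S X w).1 (joint_vector S X w).2)%:E)%E.
Proof.
case: tau_r => _ law.
pose B := [set z : k.-tuple R * n.-tuple R | t < tnth z.2 i].
have mB : measurable B.
  rewrite (_ : B = (fun z => tnth z.2 i) @^-1` `]t, +oo[%classic); last first.
    by apply/seteqP; split=> z; rewrite /B /= in_itv /= andbT.
  rewrite -[X in measurable X]setTI.
  apply: (measurableT_comp (measurable_tnth i) measurable_snd) => //.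
have EB : joint_vector S X @^-1` B = X i @^-1` `]t, +oo[%classic.
  by apply/seteqP; split=> w; rewrite /B /= in_itv /= andbT tnth_mktuple.
rewrite /stopped_above -EB law // integral_mkcond; apply: eq_integral => w _.
rewrite patchE; case: ifPn => [|]; rewrite ?inE ?notin_setE /B /= tnth_mktuple.
  by move=> ->; rewrite mul1r.
by move=> /negP/negbTE ->; rewrite mul0r.
Qed.

Lemma probability_stopped_value_gt t : 0 <= t ->
  P [set w | t < stopped_value X tau w] =
  (\int[P]_w (\sum_(i < n) (t < X i w)%R%:R *
     stop_prob r i (joint_vector S X w).1 (joint_vector S X w).2)%:E)%E.
Proof.
move=> t0; rewrite stopped_value_above // measure_semi_additive_ord; last first.
- by apply: bigsetU_measurable => i _; exact: measurable_stopped_above.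
- by move=> i j _ _ [w [[/= E _] [/= E' _]]]; rewrite E in E'; case: E'.
- exact: measurable_stopped_above.
under eq_integral do rewrite -sumEFin.
rewrite ge0_integral_sum //.
- by apply: eq_bigr => i _; exact: probability_stopped_above.
- by move=> i; apply/measurable_EFinP; exact: measurable_stop_term.
- move=> i w _; rewrite lee_fin mulr_ge0 ?ler0n // stop_prob_sample_rule mulr_ge0 ?accept_ge0 //.
  by apply: prodr_ge0 => j _; rewrite subr_ge0 accept_le1.
Qed.

End StoppedTail.

Lemma stopped_value_gt_ge (R : realType) (F : probability R R) (k n : nat) (J : finType)
    (b : 'I_n -> J) (m : J -> nat) (v p lam : J * bool -> R)
    (q := fun js => tail F (v js) + p js * (wtail F (v js) - tail F (v js))) :
  (forall js, 0 <= p js <= 1) -> (forall js, 0 < lam js) ->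
  (forall j, k%:R * q (j, false) + lam (j, false) <= (m j)%:R) ->
  (forall j, (m j)%:R <= k%:R * q (j, true) - lam (j, true)) ->
  forall (l u : nat -> R) (del : R),
  \sum_js k%:R * q js / lam js ^+ 2 <= del -> del <= 1 ->
  (forall i : 'I_n, l i = q (b i, false)) -> (forall i : 'I_n, u i = q (b i, true)) ->
  forall (d : measure_display) (T : measurableType d) (P : probability T R)
    (S : 'I_k -> {RV P >-> R}) (X : 'I_n -> {RV P >-> R}) (tau : T -> option 'I_n),
  iid_from F (joint_family S X) ->
  stopping_time_of (sample_rule R k (fun i => m (b i))) S X tau ->
  forall t, 0 <= t ->
  (((1 - del) * gain (tail F t) [seq (l i, u i) | i <- iota 0 n])%:E <=
   P [set w | (t < stopped_value X tau w)%R])%E.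
Proof.
move=> p01 lam0 ml mu l u del hdel del1 hl hu d T P S X tau iid tau_r t t0.
rewrite (probability_stopped_value_gt tau_r t0).
have h := Ex_guaranteed p01 lam0 t hdel del1 hl hu.
rewrite -lee_fin in h; apply: (le_trans h).
rewrite -(integral_joint_cell (measurable_level_set v t) iid); last first.
  by move=> e; rewrite le_max lexx.
apply: ge0_le_integral => //.
- by move=> w _; rewrite lee_fin le_max lexx.
- apply/measurable_EFinP; apply: (measurable_finite_fibers
  (fun e => Num.max 0 (guaranteed F b v p lam e))).
  by move=> e; apply: measurable_joint_cell; exact: measurable_level_set.
- by apply/measurable_EFinP; apply: measurable_sum => i; exact: measurable_stop_term.
move=> w _; rewrite lee_fin.
have := guaranteed_le b p01 lam0 ml mu.
move=> /(_ t [tuple S j w | j < k] [tuple X i w | i < n]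
  (joint_cell (level_set v t) (joint_family S X) w)) hw.
apply: le_trans (hw _ _) _.
- by move=> j; rewrite /joint_cell ffunE tnth_mktuple.
- by move=> i; rewrite /joint_cell ffunE tnth_mktuple.
by apply: ler_sum => i _; rewrite tnth_mktuple.
Qed.

(** * Comparison of expectations through tails *)

Lemma random_variable_exists (R : realType) d (T : measurableType d)
    (P : probability T R) (f : T -> R) :
  measurable_fun setT f -> exists Y : {RV P >-> R}, Y = f :> (T -> R).
Proof. by move=> mf; exists (mfun_Sub (mem_set mf : f \in mfun)). Qed.

Lemma measurable_bigmax (R : realType) d (T : measurableType d) (I : Type)
    (s : seq I) (f : I -> T -> R) : (forall i, measurable_fun setT (f i)) ->
  measurable_fun setT (fun w => \big[Num.max/0]_(i <- s) f i w).
Proof.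
move=> mf; elim: s => [|i s IH].
  by under eq_fun do rewrite big_nil; exact: measurable_cst.
by under eq_fun do rewrite big_cons; exact: measurable_maxr.
Qed.

Lemma le_expectation_of_tail (R : realType) d (T : measurableType d)
    (P : probability T R) (f g : T -> R) (c : R) :
  measurable_fun setT f -> measurable_fun setT g -> 0 <= c ->
  (forall w, 0 <= f w) -> {ae P, forall w, 0 <= g w} ->
  (forall t, 0 <= t ->
    (c%:E * P [set w | (t < f w)%R] <= P [set w | (t < g w)%R])%E) ->
  (c%:E * 'E_P[f] <= 'E_P[g])%E.
Proof.
move=> mf mg c0 f0 g0 tails.
have mg0 : measurable_fun setT (fun w => Num.max 0 (g w)) by apply: measurable_maxr.
(* The tail formula is applied to pointwise nonnegative variables, whereas [g] is nonnegative only
   almost everywhere. *)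
have -> : ('E_P[g] = 'E_P[(fun w => Num.max 0 (g w))%R])%E.
  rewrite unlock; apply: ae_eq_integral => //; [exact/measurable_EFinP|exact/measurable_EFinP|].
  by apply: filterS g0 => w gw _; rewrite max_r.
have [X EX] := random_variable_exists P mf; have [Y EY] := random_variable_exists P mg0.
rewrite -EX -EY !ge0_expectation_ccdf; last 2 first.
- by move=> w; rewrite EY le_max lexx.
- by move=> w; rewrite EX.
have mccdf (Z : {RV P >-> R}) : measurable_fun (T := R) `[0%R, +oo[%classic (ccdf (P := P) Z).
  by apply: measurable_funTS; exact: ccdf_measurable.
rewrite -ge0_integralZl_EFin //; last exact: mccdf.
apply: ge0_le_integral => //.
- by move=> t _; apply: mule_ge0; rewrite ?lee_fin //; exact: measure_ge0.
- by apply: measurable_funeM; exact: mccdf.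
- exact: mccdf.
move=> t; rewrite /= in_itv /= andbT => t0.
have := tails t t0; rewrite /ccdf /distribution /pushforward.
rewrite (_ : [set w | t < f w] = X @^-1` `]t, +oo[%classic); last first.
  by rewrite EX; apply/seteqP; split=> w /=; rewrite in_itv /= andbT.
rewrite (_ : [set w | t < g w] = Y @^-1` `]t, +oo[%classic) //.
rewrite EY; apply/seteqP; split=> w /=; rewrite in_itv /= andbT lt_max (ltNge t 0) t0 //=.
Qed.

(** * Maximum and stopped value under i.i.d. sampling *)

Section Samples.
Context (R : realType) (F : probability R R) (k n : nat) (d : measure_display)
  (T : measurableType d) (P : probability T R) (S : 'I_k -> {RV P >-> R})
  (X : 'I_n -> {RV P >-> R}) (tau : T -> option 'I_n).
Hypothesis iid : iid_from F (joint_family S X).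

Lemma probability_max_gt t : 0 <= t ->
  P [set w | t < max_value X w] = (1 - (1 - tail F t) ^+ n)%:E.
Proof.
move=> t0; case: (iid) => indep ident.
pose J : {set 'I_k + 'I_n} := [set u | if u is inr _ then true else false]%SET.
pose A (u : 'I_k + 'I_n) : set R := ~` `]t, +oo[%classic.
have mA u : measurable (A u) by exact: measurableC.
have := indep J A mA.
rewrite (_ : \bigcap_(u in _) _ = ~` [set w | t < max_value X w]); last first.
  apply/seteqP; split=> w /=.
    move=> h; apply/negP; rewrite -leNgt; apply/bigmax_leP; split=> // i _.
    have := h (inr i); rewrite /= inE => /(_ isT).
    by rewrite /A /= in_itv /= andbT => /negP; rewrite -leNgt.
  move=> /negP; rewrite -leNgt => /bigmax_leP[_ h] [l|i] /=; rewrite inE // => _.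
  by rewrite /A /= in_itv /= andbT; apply/negP; rewrite -leNgt; exact: h.
have mM : measurable [set w | t < max_value X w].
  rewrite (_ : [set _ | _] = max_value X @^-1` `]t, +oo[%classic).
    by rewrite -[X in measurable X]setTI; apply: measurable_bigmax.
  by apply/seteqP; split=> w /=; rewrite in_itv /= andbT.
rewrite probability_setC // big_mkcond big_sumType /= big1 ?mul1e; last by move=> l _; rewrite inE.
have e i : true -> (if inr i \in J then P (joint_family S X (inr i) @^-1` A (inr i)) else 1)%E
    = (1 - tail F t)%:E.
  move=> _; rewrite inE; have /= := ident (inr i) _ (mA (inr i)).
  rewrite /distribution /pushforward => ->.
  by rewrite probability_setC // -EFin_tail.
rewrite (eq_bigr _ e) prodEFin big_const_ord iter_mulr_1 => h.
have fM : P [set w | t < max_value X w] \is a fin_num by exact: fin_num_measure.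
rewrite -(fineK fM) in h *; case: h => h.
by congr (_%:E); rewrite -h opprB addrC subrK.
Qed.

Lemma ae_stopped_value_ge0 : F [set x | 0 <= x] = 1%E ->
  {ae P, forall w, 0 <= stopped_value X tau w}.
Proof.
move=> F1; have h : {ae P, forall w, forall i : 'I_n, 0 <= X i w}.
  apply: filter_forall => i.
  have neg0 : P (X i @^-1` `]-oo, 0[%classic) = 0.
    case: iid => _ /(_ (inr i) `]-oo, 0[%classic) /=.
    rewrite /distribution /pushforward => -> //.
    rewrite (_ : `]-oo, 0[%classic = ~` [set x | 0 <= x]).
      rewrite probability_setC ?F1 ?subee //.
      rewrite (_ : [set _ | _] = `[0, +oo[%classic) //.
      by apply/seteqP; split=> x /=; rewrite in_itv /= andbT.
    by apply/seteqP; split=> x /=; rewrite in_itv /= ltNge => /negP.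
  exists (X i @^-1` `]-oo, 0[%classic); split=> //.
    by rewrite -[X in measurable X]setTI; exact: measurable_funPT.
  by move=> w /= /negP; rewrite in_itv /= -ltNge.
by apply: filterS h => w Xw; rewrite /stopped_value; case: (tau w).
Qed.

Lemma measurable_stopped_value : (forall i, measurable (tau @^-1` [set Some i])) ->
  measurable_fun setT (stopped_value X tau).
Proof.
move=> mtau.
rewrite (_ : stopped_value X tau =
    fun w => \sum_(i < n) \1_(tau @^-1` [set Some i]) w * X i w).
  by apply: measurable_sum => i; apply: measurable_funM => //; exact: measurable_indic.
apply/funext => w; rewrite /stopped_value; case E: (tau w) => [i|].
  rewrite (bigD1 i) //= indicE mem_set ?E //= mul1r big1 ?addr0 // => j ji.
  rewrite indicE memNset ?mul0r //= E => -[ij]; by rewrite ij eqxx in ji.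
by rewrite big1 // => j _; rewrite indicE memNset ?mul0r //= E.
Qed.

End Samples.

(** * Choice of the parameters *)

(** The expected ranks of the two brackets differ by [kap K z / n]. A margin of a quarter of this
    gap at each end leaves half of it, which is at least [1] and so contains an integer. *)
Lemma order_statistic_rank (R : realType) (kap K n z : R) :
  0 < kap < 1 -> 0 < n -> 0 < z -> n ^+ 2 <= K -> 2 / (kap * z) <= n ->
  exists m : nat, 
   K * ((1 - kap) * (z / n)) + kap * K * z / (4 * n) <= m%:R /\
   m%:R <= K * (z / n) - kap * K * z / (4 * n).
Proof.
move=> /andP[k0 k1] n0 z0 nK hn.
have K0 : 0 < K by apply: lt_le_trans nK; rewrite exprn_gt0.
have kz0 : 0 < kap * z by exact: mulr_gt0.
set B := K * _ + _.
have B0 : 0 <= B.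
  by rewrite addr_ge0 // ?divr_ge0 ?mulr_ge0 ?(ltW k0) ?(ltW K0) ?(ltW z0) ?(ltW n0) //
    ?invr_ge0 ?subr_ge0 ltW.
exists (Num.truncn B).+1; split; first exact/ltW/Num.Theory.truncnS_gt.
have /andP[tB _] := Num.Theory.truncn_itv B0.
rewrite -natr1; apply: (@le_trans _ _ (B + 1)); first by rewrite lerD2r.
have h : 2 <= kap * K * z / n.
  rewrite ler_pdivlMr //; rewrite ler_pdivrMr // in hn.
  apply: (@le_trans _ _ (n * (kap * z) * n)); first by rewrite ler_wpM2r // ltW.
  have -> : n * (kap * z) * n = kap * z * n ^+ 2 by ring.
  have -> : kap * K * z = kap * z * K by ring.
  by rewrite ler_wpM2l // ltW.
have -> : B = K * (z / n) - 3 / 4 * (kap * K * z / n).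
  by rewrite /B; field; rewrite gt_eqF.
have -> : kap * K * z / (4 * n) = (kap * K * z / n) / 4 by field; rewrite gt_eqF.
set Q := kap * K * z / n in h *; lra.
Qed.

(** Variance over squared margin is at most [16 n / (kap^2 z K)], of order [1 / n] because
    [K >= n^2]. The [2 M] brackets share a failure budget of [kap]. *)
Lemma deviation_bound (R : realType) (kap K n z M q : R) :
  0 < kap < 1 -> 0 < n -> 0 < z -> 0 < M -> n ^+ 2 <= K -> 32 * M / (kap ^+ 3 * z) <= n ->
  0 <= q <= z / n ->
  K * q / (kap * K * z / (4 * n)) ^+ 2 <= kap / (2 * M).
Proof.
move=> /andP[k0 k1] n0 z0 M0 nK hn /andP[q0 qz].
have K0 : 0 < K by apply: lt_le_trans nK; rewrite exprn_gt0.
have kz0 : 0 < kap ^+ 3 * z by rewrite mulr_gt0 ?exprn_gt0.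
apply: (@le_trans _ _ (K * (z / n) / (kap * K * z / (4 * n)) ^+ 2)).
  by rewrite ler_wpM2r ?invr_ge0 ?sqr_ge0 // ler_wpM2l // ltW.
have -> : K * (z / n) / (kap * K * z / (4 * n)) ^+ 2 = 16 * n / (kap ^+ 2 * z * K).
  by field; rewrite !gt_eqF.
rewrite ler_pdivlMr ?mulr_gt0 // mulrAC ler_pdivrMr ?mulr_gt0 ?exprn_gt0 //.
rewrite ler_pdivrMr // in hn.
have h1 : 32 * M * n <= kap ^+ 3 * z * K.
  apply: (@le_trans _ _ (n * (kap ^+ 3 * z) * n)); first by rewrite ler_wpM2r // ltW.
  have -> : n * (kap ^+ 3 * z) * n = kap ^+ 3 * z * n ^+ 2 by ring.
  by rewrite ler_wpM2l // ltW.
have -> : 16 * n * (2 * M) = 32 * M * n by ring.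
by have -> : kap * (kap ^+ 2 * z * K) = kap ^+ 3 * z * K by ring.
Qed.

Theorem theorem12 (R : realType) (eps : R) (eps_gt0 : 0 < eps) :
  exists (C : R) (n_eps : nat), 0 < C /\
  forall n : nat, (0 < n)%N -> (n_eps <= n)%N ->
  exists r : stopping_rule R `|Num.ceil (C * n%:R ^+ 2)|%N n,
  forall F : probability R R, nonneg_finite_mean F ->
  forall (d : measure_display) (T : measurableType d) (P : probability T R)
    (S : 'I_(`|Num.ceil (C * n%:R ^+ 2)|%N) -> {RV P >-> R})
    (X : 'I_n -> {RV P >-> R}) (tau : T -> option 'I_n),
  iid_from F (joint_family S X) ->
  stopping_time_of r S X tau ->
  ((745 / 1000 - eps)%:E * 'E_P[max_value X] <= 'E_P[stopped_value X tau])%E.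
Proof.
(* Three factors [1 - kap] are lost, two in [schedule] and one to bad samples, and
   [(1 - kap)^3 >= 1 - 3 kap]. *)
pose kap : R := Num.min (eps / 3) (1 / 2).
have k0 : 0 < kap by rewrite lt_min !divr_gt0 ?ltr0n.
have k1 : kap < 1 by rewrite gt_min; apply/orP; right; lra.
have keps : 3 * kap <= eps by rewrite mulrC -ler_pdivlMr // ge_min lexx.
have k01 : 0 < kap < 1 by rewrite k0.
have [M [n0 [z [M0 z0 sched]]]] := schedule k01.
have MR0 : 0 < M%:R :> R by rewrite ltr0n.
have [n1 hn1] := finite_natr_bound z M.
have [n2 hn2] := finite_natr_bound (fun j => 2 / (kap * z j)) M.
have [n3 hn3] := finite_natr_bound (fun j => 32 * M%:R / (kap ^+ 3 * z j)) M.
(* [C = 1] serves every [eps]: the relative error of a rank of order [n] vanishes as [n] grows, so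
   only [n_eps] depends on [eps]. *)
exists 1, (maxn (maxn n0 n1) (maxn n2 n3)); split=> // n n_gt0.
rewrite !geq_max => /andP[/andP[h0 h1] /andP[h2 h3]].
set k := `|_|%N.
have nR0 : 0 < n%:R :> R by rewrite ltr0n.
have nk : n%:R ^+ 2 <= k%:R :> R.
  have c0 : 0 <= Num.ceil (1 * n%:R ^+ 2 : R)
    by rewrite ceil_ge0 // mul1r (lt_le_trans (ltrN10 _)) // sqr_ge0.
  rewrite /k natr_absz ger0_norm //; apply: le_trans (ceil_ge _); by rewrite mul1r.
have [b [bM hgain]] := sched n h0.
pose J := 'I_M.
have /choice[m hm] (j : J) : exists m : nat,
   k%:R * ((1 - kap) * (z j / n%:R)) + kap * k%:R * z j / (4 * n%:R) <= m%:R /\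
   m%:R <= k%:R * (z j / n%:R) - kap * k%:R * z j / (4 * n%:R) :> R.
  by apply: order_statistic_rank => //; apply/ltW/hn2.
pose bJ (i : 'I_n) : J := Ordinal (bM i).
exists (sample_rule R k (fun i => m (bJ i))) => F [F1 _] d T P S X tau iid tau_r.
pose q (js : J * bool) : R := (if js.2 then 1 else 1 - kap) * (z js.1 / n%:R).
have zn0 (j : J) : 0 < z j / n%:R by rewrite divr_gt0.
have zn1 (j : J) : z j / n%:R < 1 by rewrite ltr_pdivrMr // mul1r hn1.
have q0 js : 0 < q js by rewrite mulr_gt0 //; case: (js.2); rewrite ?subr_gt0.
have qz js : q js <= z js.1 / n%:R.
  by rewrite ler_piMl ?(ltW (zn0 _)) //; case: (js.2); rewrite // gerBl ltW.
have /choice[vp hvp] js : exists vp : R * R, 0 <= vp.2 <= 1 /\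
    tail F vp.1 + vp.2 * (wtail F vp.1 - tail F vp.1) = q js.
  have [|v [p h]] := @quantile_exists R F (q js); last by exists (v, p).
  by rewrite q0 (le_lt_trans (qz js)).
pose lam (js : J * bool) : R := kap * k%:R * z js.1 / (4 * n%:R).
have kR0 : 0 < k%:R :> R by apply: lt_le_trans nk; rewrite exprn_gt0.
have lam0 js : 0 < lam js by rewrite divr_gt0 ?mulr_gt0 //; exact: z0.
have main t : 0 <= t ->
    (((1 - kap) * gain (tail F t) [seq ((1 - kap) * (z (b i) / n%:R), z (b i) / n%:R)
       | i <- iota 0 n])%:E <= P [set w | (t < stopped_value X tau w)%R])%E.
  have qE js : tail F (vp js).1 + (vp js).2 * (wtail F (vp js).1 - tail F (vp js).1) = q js.
    by case: (hvp js).
  apply: (stopped_value_gt_ge (F := F) (b := bJ) (m := m) (v := fun js => (vp js).1)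
    (p := fun js => (vp js).2) (lam := lam)
    (l := fun i => (1 - kap) * (z (b i) / n%:R)) (u := fun i => z (b i) / n%:R)
      _ _ _ _ _ _ _ _ iid tau_r) => //.
  - by move=> js; case: (hvp js).
  - by move=> j; rewrite qE; case: (hm j).
  - by move=> j; rewrite qE /q /= mul1r; case: (hm j).
  - apply: (@le_trans _ _ (\sum_(js : J * bool) kap / (2 * M%:R))).
      apply: ler_sum => js _; rewrite qE; apply: deviation_bound => //.
        exact/ltW/hn3.
      by rewrite ltW ?q0 //= qz.
    rewrite sumr_const card_prod card_ord card_bool mulrnA -[_ *+ M]mulr_natr -[_ *+ 2]mulr_natr.
    by rewrite le_eqVlt; apply/orP; left; apply/eqP; field; rewrite gt_eqF.
  - exact: ltW.
  - by move=> i; rewrite qE /q /= mul1r.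
pose c : R := (1 - kap) ^+ 3 * (149 / 200).
have c0 : 0 <= c by rewrite mulr_ge0 ?exprn_ge0 ?subr_ge0 ?(ltW k1).
have max0 w : 0 <= max_value X w by apply/bigmax_geP; left.
apply: (@le_trans _ _ (c%:E * 'E_P[max_value X])%E).
  apply: lee_wpmul2r; first by rewrite unlock; apply: integral_ge0 => w _; rewrite lee_fin.
  rewrite lee_fin /c (_ : 745 / 1000 = 149 / 200).
    have : 0 <= 149 / 200 :> R by rewrite divr_ge0 ?ler0n.
    have : 149 / 200 <= 1 :> R by rewrite ler_pdivrMr ?ltr0n // mul1r ler_nat.
    move: (149 / 200 : R) (kap) k0 k1 keps => C x x0 x1 xeps C1 C0.
    have cube : 1 - 3 * x <= (1 - x) ^+ 3.
      rewrite -subr_ge0 (_ : _ - _ = x ^+ 2 * (3 - x)); last by ring.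
      by rewrite mulr_ge0 ?sqr_ge0 //; lra.
    apply: le_trans (ler_wpM2r C0 cube).
    have : 3 * x * C <= 3 * x * 1 by rewrite ler_wpM2l // mulr_ge0 ?ler0n // ltW.
    lra.
  have -> : 745%:R = 5%:R * 149%:R :> R by rewrite -natrM.
  have -> : 1000%:R = 5%:R * 200%:R :> R by rewrite -natrM.
  by rewrite -mulf_div divff ?mul1r ?pnatr_eq0.
apply: le_expectation_of_tail => //.
- by apply: measurable_bigmax.
- by case: tau_r => mtau _; exact: measurable_stopped_value.
- exact: ae_stopped_value_ge0 iid F1.
move=> t t0; apply: le_trans (main t t0).
rewrite (probability_max_gt iid t0) -EFinM lee_fin.
have a01 : 0 <= tail F t <= 1 by rewrite tail_ge0 tail_le1.
apply: le_trans (ler_wpM2l _ (hgain _ a01)); last by rewrite subr_ge0 ltW.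
by rewrite /c exprS !mulrA.
Qed.
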